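(* For all integers $n\ge 0$ the following congruences modulo 2 hold: $$b_{50}(875n - 26 + 25B) \equiv p_{23}(35n+B) \text{ for } B \in \{11, 18, 21, 26, 28, 33\};$$ $$b_{100}(875n - 26 + 25B) \equiv p_{21}(35n+B) \text{ for } B \in \{6, 12, 17, 26, 27, 31\};$$ $$b_{200}(6125n - 26 + 25B) \equiv p_{17}(245n+B) \text{ for } B \in \{22, 29, 92, 127, 169, 239\};$$ $$b_{400}(1125n - 26 + 25B) \equiv p_{9}(45n+B) \text{ for } B \in \{3, 9, 18, 39\};$$ $$b_{232}(841n - 35 + 29B) \equiv p_{21}(29n+B) \text{ for } B \in \{3, 6, 10, 12, 13, 14, 15, 18, 20, 23, 24, 25, 26, 28\}.$$
   Context: For a positive integer $m$, $b_m(n)$ denotes the number of partitions of $n$ none of whose parts is divisible by $m$; equivalently $\sum_{n\ge0} b_m(n)q^n = \prod_{i\ge1}(1-q^{mi})/(1-q^i)$. For a positive integer $t$, $p_t(n)$ denotes the number of $t$-multipartitions of $n$ (ordered $t$-tuples of partitions with total size $n$); equivalently $\sum_{n\ge0}p_t(n)q^n=\prod_{i\ge1}(1-q^i)^{-t}$. *)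

(* Defs.v *)
From mathcomp Require Import all_boot.

Set Implicit Arguments.
Unset Strict Implicit.
Unset Printing Implicit Defensive.

(* A partition is the nonincreasing list of its (positive) parts. *)
Definition is_partition (s : seq nat) : bool := sorted geq s && (0 \notin s).

(* A partition of size at most n has at most n parts, each at most n, so all
   such partitions live in the finite type n.-bseq 'I_n.+1; this loses
   nothing, see bounded_partition. *)
Definition parts (n : nat) (u : n.-bseq 'I_n.+1) : seq nat :=
  [seq val i | i <- u].

Lemma bounded_partition (n : nat) (s : seq nat) :
  is_partition s -> sumn s <= n -> exists u : n.-bseq 'I_n.+1, parts u = s.
Proof.
case/andP=> _ s_gt0 s_le.
have szs: size s <= n.
  apply: leq_trans s_le; elim: s s_gt0 => //= x s IHs.
  rewrite inE negb_or eq_sym -lt0n => /andP[x_gt0 /IHs sz_s].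
  by rewrite -add1n leq_add.
have s_ord: all (gtn n.+1) s.
  apply/allP=> x s_x /=; rewrite ltnS (leq_trans _ s_le) //.
  elim: s s_x {s_gt0 s_le szs} => //= y s IHs; rewrite inE.
  by case/predU1P=> [->|/IHs le_x]; rewrite ?leq_addr // (leq_trans le_x) ?leq_addl.
have szu: size (map (@inord n) s) <= n by rewrite size_map.
exists (Bseq szu); rewrite /parts /= -map_comp -[RHS]map_id.
by apply/eq_in_map=> x /(allP s_ord) ltxn; rewrite /= inordK.
Qed.

(* Number of partitions of n with no part divisible by m. *)
Definition b (m n : nat) : nat :=
  #|[set u : n.-bseq 'I_n.+1 |
      [&& is_partition (parts u), sumn (parts u) == n
        & all (fun k => ~~ (m %| k)) (parts u)]]|.

(* Number of ordered t-tuples of partitions with total size n. *)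
Definition p (t n : nat) : nat :=
  #|[set w : t.-tuple (n.-bseq 'I_n.+1) |
      all (fun u => is_partition (parts u)) w
        && (\sum_(i < t) sumn (parts (tnth w i)) == n)]|.

(* Main.v *)
Require Import Defs.
From HB Require Import structures.
From mathcomp Require Import all_boot all_algebra all_field.
From mathcomp Require Import boolp cyclic.
From mathcomp Require Import zify ring.

Set Implicit Arguments.
Unset Strict Implicit.
Unset Printing Implicit Defensive.

Import GRing.Theory.

(* Work with power series over a field k of characteristic 2 containing primitive
   roots of unity of orders 5, 7 and 29. Let E = prod (1 - q^i), phi = 1 / E,
   t = q^(1/24) and psi = sum_(n odd) t^(n^2). Then eta = t E(t^24) equals
   psi(t) + psi(t^9), and a count of representations by a^2 + 3 b^2 gives
   psi(t)^4 + psi(t^3)^4 = psi(t) psi(t^3) and eta(t)^3 = psi(t^3).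

   For l = 5, 7, 29, eta(t) and eta(t^l) satisfy
     X^(l+1) + Y^(l+1) + X Y + (a few further monomials) = 0.
   The polynomial has a unique root Y = t^l + ... at X = eta(t).
   That this root is eta(t^l) follows from finitely many coefficients: both
   satisfy a known equation relating Y(t) to Y(t^p), p = 3 or 5, because a nonzero
   element of a filtered ring whose pieces have few elements over F_2 cannot have
   too large an order (in place of Sturm's bound for modular forms).

   The roots of the equation at Y = eta(t^l) are eta(z t), z^l = 1, and
   eta(t^(l^2)). Summing their inverses or powers gives, modulo 2,
     sum phi_(25N-26) q^N = phi^25 + q phi + phi(q^5)^5,
     sum phi_(29N-35) q^N = phi^29 + q phi^5 + phi(q^29),
     sum (E^7)_(7N) q^N   = E + q^2 E(q^7)^7.
   Since E(q^(2^j)) = E^(2^j), multiplying the first identity by E^(2^j) turns the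
   left side into the generating function of b_(25 2^j)(25N - 26), and the right
   side into phi^(25 - 2^j) plus two terms: q E^(2^j - 1) and
   E(q^(2^j)) phi(q^5)^5. Both vanish at the required exponents because E and E^3
   are supported on {n | 24n+1 is a square} and {n | 8n+1 is a square}, where
   E^7 is reduced to E by the third identity and E^15 = E^3 E(q^4)^3. The second
   identity, multiplied by E^8, is treated in the same way. *)

(** * Formal power series *)

Record fps (k : Type) := Fps {coefs : nat -> k}.

HB.instance Definition _ (k : Type) := gen_eqMixin (fps k).
HB.instance Definition _ (k : Type) := gen_choiceMixin (fps k).

Notation "a @_ n" := (coefs a n%N) (at level 9, n at level 2, format "a @_ n").

Section SeriesRing.
Local Open Scope ring_scope.
Variable k : fieldType.
Implicit Types a b c : fps k.

Lemma fpsP a b : (forall n, a@_n = b@_n) -> a = b.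
Proof. by case: a b => [a] [b] /= e; congr Fps; apply/funext. Qed.

Definition fps0 : fps k := Fps (fun=> 0).
Definition fps1 : fps k := Fps (fun n => (n == 0)%N%:R).
Definition fps_opp a : fps k := Fps (fun n => - a@_n).
Definition fps_add a b : fps k := Fps (fun n => a@_n + b@_n).
Definition fps_mul a b : fps k := Fps (fun n => \sum_(i < n.+1) a@_i * b@_(n - i)).

Lemma fps_addA : associative fps_add.
Proof. by move=> a b c; apply/fpsP=> n /=; rewrite addrA. Qed.
Lemma fps_addC : commutative fps_add.
Proof. by move=> a b; apply/fpsP=> n /=; rewrite addrC. Qed.
Lemma fps_add0 : left_id fps0 fps_add.
Proof. by move=> a; apply/fpsP=> n /=; rewrite add0r. Qed.
Lemma fps_addN : left_inverse fps0 fps_opp fps_add.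
Proof. by move=> a; apply/fpsP=> n /=; rewrite addNr. Qed.

HB.instance Definition _ :=
  GRing.isZmodule.Build (fps k) fps_addA fps_addC fps_add0 fps_addN.

Definition trunc n a : {poly k} := \poly_(i < n) a@_i.

Lemma coef_trunc n a i : (i < n)%N -> (trunc n a)`_i = a@_i.
Proof. by move=> i_n; rewrite coef_poly i_n. Qed.

Lemma coef_mul_poly (p q : {poly k}) a b n :
    (forall i, (i <= n)%N -> p`_i = a@_i) ->
    (forall i, (i <= n)%N -> q`_i = b@_i) ->
  (fps_mul a b)@_n = (p * q)`_n.
Proof.
move=> ep eq; rewrite coefM; apply: eq_bigr => -[i /= lt_in] _.
by rewrite ep ?eq ?leq_subr.
Qed.

Lemma coef_mul_trunc a b n N : (n < N)%N ->
  (fps_mul a b)@_n = (trunc N a * trunc N b)`_n.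
Proof.
move=> ltnN; apply: coef_mul_poly => i lein;
  by rewrite coef_trunc // (leq_ltn_trans lein).
Qed.

Lemma fps_mulA : associative fps_mul.
Proof.
move=> a b c; apply/fpsP => n.
rewrite (@coef_mul_poly (trunc n.+1 a) (trunc n.+1 b * trunc n.+1 c)).
- rewrite mulrA -(@coef_mul_poly _ _ (fps_mul a b) c) // => i lein.
    by rewrite -coef_mul_trunc.
  by rewrite coef_trunc.
- by move=> i lein; rewrite coef_trunc.
by move=> i lein; rewrite -coef_mul_trunc.
Qed.

Lemma fps_mulC : commutative fps_mul.
Proof.
by move=> a b; apply/fpsP => n; rewrite !(@coef_mul_trunc _ _ n n.+1) // mulrC.
Qed.

Lemma fps_mul1 : left_id fps1 fps_mul.
Proof.
move=> a; apply/fpsP => n /=; rewrite big_ord_recl /= subn0 mul1r big1 ?addr0 //.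
by move=> i _; rewrite mul0r.
Qed.

Lemma fps_mulDl : left_distributive fps_mul fps_add.
Proof.
move=> a b c; apply/fpsP=> n /=; rewrite -big_split /=.
by apply: eq_bigr => i _; rewrite mulrDl.
Qed.

Lemma fps1_neq0 : fps1 != fps0.
Proof. by apply/eqP=> /(congr1 (fun a => a@_0)) /eqP /=; rewrite oner_eq0. Qed.

HB.instance Definition _ := GRing.Zmodule_isComNzRing.Build (fps k)
  fps_mulA fps_mulC fps_mul1 fps_mulDl fps1_neq0.

Lemma fcoef0 n : (0 : fps k)@_n = 0. Proof. by []. Qed.
Lemma fcoef1 n : (1 : fps k)@_n = (n == 0)%N%:R. Proof. by []. Qed.
Lemma fcoefD a b n : (a + b)@_n = a@_n + b@_n. Proof. by []. Qed.
Lemma fcoefN a n : (- a)@_n = - a@_n. Proof. by []. Qed.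
Lemma fcoefB a b n : (a - b)@_n = a@_n - b@_n. Proof. by []. Qed.
Lemma fcoefM a b n : (a * b)@_n = \sum_(i < n.+1) a@_i * b@_(n - i).
Proof. by []. Qed.

Lemma fcoef_sum (I : Type) (r : seq I) (P : pred I) (F : I -> fps k) n :
  (\sum_(i <- r | P i) F i)@_n = \sum_(i <- r | P i) (F i)@_n.
Proof. by elim/big_rec2: _ => // i _ a _ <-. Qed.

Lemma fcoefMn a m n : (a *+ m)@_n = a@_n *+ m.
Proof. by elim: m => // m IHm; rewrite !mulrS -IHm. Qed.

Lemma fcoef_natr m n : (m%:R : fps k)@_n = m%:R *+ (n == 0)%N.
Proof. by rewrite fcoefMn fcoef1; case: eqP => _; rewrite ?mul0rn. Qed.

Lemma fcoefM0 a b : (a * b)@_0 = a@_0 * b@_0.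
Proof. by rewrite fcoefM big_ord1 subn0. Qed.

Lemma fcoefX0 a m : (a ^+ m)@_0 = a@_0 ^+ m.
Proof. by elim: m => // m IHm; rewrite !exprS fcoefM0 IHm. Qed.

Definition ordge n a := forall i, (i < n)%N -> a@_i = 0.

Lemma ordgeW m n a : (n <= m)%N -> ordge m a -> ordge n a.
Proof. by move=> le_nm a_m i lt_in; apply: a_m; apply: leq_trans le_nm. Qed.

Lemma ordge0 n : ordge n 0. Proof. by []. Qed.

Lemma ordgeD n a b : ordge n a -> ordge n b -> ordge n (a + b).
Proof. by move=> an bn i lt_in; rewrite fcoefD an ?bn ?addr0. Qed.

Lemma ordgeN n a : ordge n a -> ordge n (- a).
Proof. by move=> an i lt_in; rewrite fcoefN an ?oppr0. Qed.

Lemma ordgeB n a b : ordge n a -> ordge n b -> ordge n (a - b).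
Proof. by move=> an bn; apply/ordgeD/ordgeN. Qed.

Lemma ordge_sum n (I : eqType) (r : seq I) (P : pred I) (F : I -> fps k) :
  (forall i, i \in r -> P i -> ordge n (F i)) -> ordge n (\sum_(i <- r | P i) F i).
Proof.
move=> Fn; rewrite big_seq_cond; elim/big_ind: _ => //; first exact: ordgeD.
by move=> i /andP[ri Pi]; apply: Fn.
Qed.

Lemma ordgeM m n a b : ordge m a -> ordge n b -> ordge (m + n) (a * b).
Proof.
move=> am bn i lt_i; rewrite fcoefM big1 // => -[j /= lt_j] _.
have [lt_jm | le_mj] := ltnP j m; first by rewrite am ?mul0r.
by rewrite bn ?mulr0 //; lia.
Qed.

Lemma ordgeMl m a b : ordge m a -> ordge m (a * b).
Proof. by move=> am; rewrite -[m]addn0; apply: ordgeM. Qed.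

Lemma ordgeMr m a b : ordge m b -> ordge m (a * b).
Proof. by rewrite mulrC; apply: ordgeMl. Qed.

Lemma ordgeX m n a : ordge m a -> ordge (m * n) (a ^+ n).
Proof.
move=> am; elim: n => [|n IHn]; first by rewrite muln0.
by rewrite mulnS exprS; apply: ordgeM.
Qed.

Lemma coefM_ord m n a b : ordge m a -> ordge n b ->
  (a * b)@_(m + n) = a@_m * b@_n.
Proof.
move=> am bn; rewrite fcoefM.
have lt_m : (m < (m + n).+1)%N by lia.
rewrite (bigD1 (Ordinal lt_m)) //= addKn big1 ?addr0 // => -[j /= lt_j].
rewrite -val_eqE /= => ne_jm.
have [lt_jm | le_mj] := ltnP j m; first by rewrite am ?mul0r.
by rewrite bn ?mulr0 //; lia.
Qed.

Lemma coefX_ord m n a : ordge m a -> (a ^+ n)@_(m * n) = a@_m ^+ n.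
Proof.
move=> am; elim: n => [|n IHn]; first by rewrite muln0 !expr0.
by rewrite mulnS !exprS coefM_ord ?IHn //; apply: ordgeX.
Qed.

Lemma ord_exists a : a != 0 -> exists2 n, ordge n a & a@_n != 0.
Proof.
move=> a_nz; have ex_n : exists n, a@_n != 0.
  apply: contrapT => a0; case/negP: a_nz; apply/eqP/fpsP=> n.
  by apply: contrapT => an; apply: a0; exists n; apply/eqP.
exists (ex_minn ex_n); last by case: ex_minnP.
case: ex_minnP => n _ min_n i lt_in.
by apply/eqP; rewrite -[_ == _]negbK; apply: contraTN lt_in => /min_n; rewrite -leqNgt.
Qed.

Lemma ordge_eq0 a : (forall n, ordge n a) -> a = 0.
Proof. by move=> a0; apply/fpsP => n; rewrite (a0 n.+1). Qed.

Lemma fps_integral a b : a * b = 0 -> (a == 0) || (b == 0).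
Proof.
move=> ab0; apply/norP => -[/ord_exists[m am a_nz] /ord_exists[n bn b_nz]].
have /eqP := coefM_ord am bn; rewrite ab0 fcoef0 eq_sym mulf_eq0.
by rewrite (negPf a_nz) (negPf b_nz).
Qed.

Definition fps_unit := [qualify a a : fps k | a@_0 != 0].

(* Geometric series in [1 - a / a@_0]. *)
Definition fps_inv a : fps k :=
  if a@_0 == 0 then a
  else Fps (fun n => (a@_0)^-1 *
         (\sum_(i < n.+1) (1 - Fps (fun j => (a@_0)^-1 * a@_j)) ^+ i)@_n).

Lemma fps_mulV : {in fps_unit, left_inverse 1 fps_inv *%R}.
Proof.
move=> a; rewrite qualifE /= => a_nz; rewrite /fps_inv (negPf a_nz).
set c : fps k := Fps (fun j => (a@_0)^-1 * a@_j); set d : fps k := 1 - c.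
set g := (X in X * a).
have d_ord : ordge 1 d.
  by case=> // _; rewrite fcoefB fcoef1 /= mulVf ?subrr.
(* The geometric sum is cut at the index of the coefficient. Since d has order at least 1, a later
   cut gives the same coefficient, so one cut serves the whole convolution. *)
have gE m n : (n <= m)%N -> g@_n = (a@_0)^-1 * (\sum_(i < m.+1) d ^+ i)@_n.
  move=> le_nm; rewrite /g /=; congr (_ * _).
  rewrite -!(big_mkord xpredT (fun i => d ^+ i)) [in RHS](big_cat_nat (n := n.+1)) //=.
  rewrite [X in _ = _ + X](_ : _ = 0) ?addr0 // fcoef_sum big_nat big1 // => i /andP[lt_ni _].
  by rewrite (ordgeX (n := i) d_ord) // mul1n.
apply/fpsP => n; transitivity (((\sum_(i < n.+1) d ^+ i) * c)@_n).
  rewrite !fcoefM; apply: eq_bigr => i _; rewrite (gE n) -1?ltnS //.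
  by rewrite -[RHS]mulrCA mulrA.
have -> : c = 1 - d by rewrite /d; ring.
have -> : (\sum_(i < n.+1) d ^+ i) * (1 - d) = 1 - d ^+ n.+1.
  by rewrite -[RHS]opprB subrX1 -mulNr [- (d - 1)]opprB mulrC.
by rewrite fcoefB (ordgeX (n := n.+1) d_ord) ?subr0 // mul1n.
Qed.

Lemma fps_unitPl a b : b * a = 1 -> a \is a fps_unit.
Proof.
move=> /(congr1 (fun c => c@_0)); rewrite fcoefM0 fcoef1 /= => ba1.
by rewrite qualifE; apply: contra_eq_neq ba1 => ->; rewrite mulr0 eq_sym oner_neq0.
Qed.

Lemma fps_inv_out : {in [predC fps_unit], fps_inv =1 id}.
Proof. by move=> a; rewrite inE qualifE /= negbK /fps_inv => ->. Qed.

HB.instance Definition _ := GRing.ComNzRing_hasMulInverse.Build (fps k)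
  fps_mulV fps_unitPl fps_inv_out.

HB.instance Definition _ := GRing.ComUnitRing_isIntegral.Build (fps k) fps_integral.

Lemma fps_unitE a : (a \is a GRing.unit) = (a@_0 != 0).
Proof. by []. Qed.

Definition eqm n a b := ordge n (a - b).

Lemma eqmP n a b : eqm n a b <-> (forall i, (i < n)%N -> a@_i = b@_i).
Proof.
split=> ab i lt_in; last by rewrite fcoefB ab ?subrr.
by apply/eqP; rewrite -subr_eq0 -fcoefB ab.
Qed.

Lemma eqm_refl n a : eqm n a a. Proof. by rewrite /eqm subrr. Qed.
Hint Resolve eqm_refl : core.

Lemma eqm_sym n a b : eqm n a b -> eqm n b a.
Proof. by move=> ab; rewrite /eqm -opprB; apply: ordgeN. Qed.

Lemma eqm_trans n a b c : eqm n a b -> eqm n b c -> eqm n a c.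
Proof. by move=> ab bc; rewrite /eqm -[a](subrK b) -addrA; apply: ordgeD. Qed.

Lemma eqmD n a b c d : eqm n a b -> eqm n c d -> eqm n (a + c) (b + d).
Proof. by move=> ab cd; rewrite /eqm opprD addrACA; apply: ordgeD. Qed.

Lemma eqmM n a b c d : eqm n a b -> eqm n c d -> eqm n (a * c) (b * d).
Proof.
move=> ab cd; have -> : a * c = (a - b) * c + b * (c - d) + b * d by ring.
by rewrite /eqm addrK; apply: ordgeD; [apply: ordgeMl | apply: ordgeMr].
Qed.

Lemma eqmX n m a b : eqm n a b -> eqm n (a ^+ m) (b ^+ m).
Proof. by move=> ab; elim: m => // m IHm; rewrite !exprS; apply: eqmM. Qed.

Lemma eqm_sum n (I : eqType) (r : seq I) (P : pred I) (F G : I -> fps k) :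
  (forall i, i \in r -> P i -> eqm n (F i) (G i)) ->
  eqm n (\sum_(i <- r | P i) F i) (\sum_(i <- r | P i) G i).
Proof. by move=> FG; rewrite /eqm -sumrB; apply: ordge_sum. Qed.

Lemma eqmW m n a b : (n <= m)%N -> eqm m a b -> eqm n a b.
Proof. exact: ordgeW. Qed.

Lemma eqm_eq a b : (forall n, eqm n a b) -> a = b.
Proof. by move=> ab; apply/eqP; rewrite -subr_eq0; apply/eqP/ordge_eq0. Qed.

Definition tX : fps k := Fps (fun n => (n == 1)%N%:R).

Lemma coef_tXM a n : (tX * a)@_n = if n is m.+1 then a@_m else 0.
Proof.
case: n => [|n]; first by rewrite fcoefM0 mul0r.
rewrite fcoefM !big_ord_recl big1 => [|i _]; last by rewrite mul0r.
by rewrite mul0r mul1r add0r addr0 /bump /= subn1.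
Qed.

Lemma coef_tXnM m a n : (tX ^+ m * a)@_n = if (n < m)%N then 0 else a@_(n - m).
Proof.
elim: m n => [|m IHm] n; first by rewrite mul1r subn0.
by rewrite exprS -mulrA coef_tXM; case: n => // n; rewrite IHm.
Qed.

Lemma coef_tXn m n : (tX ^+ m)@_n = (n == m)%:R.
Proof.
rewrite -[tX ^+ m]mulr1 coef_tXnM fcoef1 subn_eq0.
by case: (ltngtP n m).
Qed.

Lemma tX_neq0 : tX != 0.
Proof. by apply/eqP=> /(congr1 (fun a => a@_1)) /eqP; rewrite oner_eq0. Qed.

(** For m > 0 this is the substitution of [tX ^+ m] for the variable, written a(q^m) in formulas. *)
Definition dil m a : fps k := Fps (fun n => if (m %| n)%N then a@_(n %/ m) else 0).

Lemma coef_dil m a n : (dil m a)@_n = if (m %| n)%N then a@_(n %/ m) else 0.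
Proof. by []. Qed.

Lemma coef_dil_mul m a n : (0 < m)%N -> (dil m a)@_(m * n) = a@_n.
Proof. by move=> m_gt0; rewrite coef_dil dvdn_mulr // mulKn. Qed.

Lemma coef_dil_trunc m a n N : (0 < m)%N -> (n < N)%N ->
  (dil m a)@_n = (trunc N a \Po 'X^m)`_n.
Proof.
move=> m_gt0 lt_nN; rewrite coef_comp_poly_Xn // coef_dil.
by case: ifP => // _; rewrite coef_trunc // (leq_ltn_trans (leq_div _ _)).
Qed.

Lemma dilB m a b : dil m (a - b) = dil m a - dil m b.
Proof.
by apply/fpsP => n; rewrite fcoefB !coef_dil fcoefB; case: ifP; rewrite ?subr0.
Qed.

Lemma dilM m a b : (0 < m)%N -> dil m (a * b) = dil m a * dil m b.
Proof.
move=> m_gt0; apply/fpsP => n.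
rewrite (@coef_mul_poly (trunc n.+1 a \Po 'X^m) (trunc n.+1 b \Po 'X^m));
  try by move=> i le_in; rewrite -coef_dil_trunc.
rewrite -comp_polyM coef_comp_poly_Xn // coef_dil; case: ifP => // _.
by apply: coef_mul_trunc; rewrite ltnS leq_div.
Qed.

Lemma dil1 m : dil m 1 = 1.
Proof.
apply/fpsP => n; rewrite coef_dil !fcoef1; case: (posnP m) => [->|m_gt0].
  by rewrite dvd0n; case: n.
case: ifP => [/dvdnP[e ->]|]; first by rewrite mulnK // muln_eq0 [m == 0]gtn_eqF ?orbF.
by case: n => //; rewrite dvdn0.
Qed.

(** Positivity is built into the index, so that the morphism instances are found for numerals such
    as [dil 24]. *)
Fact dil_monoid m : monoid_morphism (dil m.+1).
Proof. by split=> [|a b]; rewrite ?dil1 ?dilM. Qed.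
HB.instance Definition _ m := GRing.isZmodMorphism.Build _ _ (dil m.+1) (dilB m.+1).
HB.instance Definition _ m := GRing.isMonoidMorphism.Build _ _ (dil m.+1) (dil_monoid m).

Lemma dilD m a b : dil m (a + b) = dil m a + dil m b.
Proof.
by apply/fpsP => n; rewrite fcoefD !coef_dil fcoefD; case: ifP; rewrite ?addr0.
Qed.

Lemma dil0 m : dil m 0 = 0.
Proof. by apply/fpsP => n; rewrite coef_dil; case: ifP. Qed.

Lemma dilX m n a : (0 < m)%N -> dil m (a ^+ n) = dil m a ^+ n.
Proof. by case: m => // m _; rewrite rmorphXn. Qed.

Lemma dil_dil m n a : (0 < m)%N -> (0 < n)%N -> dil m (dil n a) = dil (m * n) a.
Proof.
move=> m_gt0 n_gt0; apply/fpsP => i; rewrite !coef_dil.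
have [/dvdnP[j ->]|ndv] := boolP (m %| i)%N.
  by rewrite mulnK // [(j * m)%N]mulnC dvdn_pmul2l // divnMl.
by case: ifP => // /(dvdn_trans (dvdn_mulr n (dvdnn m))); rewrite (negPf ndv).
Qed.

Lemma dil_tX m : (0 < m)%N -> dil m tX = tX ^+ m.
Proof.
move=> m_gt0; apply/fpsP => n; rewrite coef_dil coef_tXn.
case: ifP => [/dvdnP[e ->]|]; first by rewrite mulnK //= -{2}[m]mul1n eqn_pmul2r.
by case: eqP => // ->; rewrite dvdnn.
Qed.

Lemma dil_inj m : (0 < m)%N -> injective (dil m).
Proof.
move=> m_gt0 a b /(congr1 (@coefs k)) ab; apply/fpsP => n.
by rewrite -(coef_dil_mul a n m_gt0) ab coef_dil_mul.
Qed.

Lemma ordge_dil m n a : ordge n a -> ordge (m * n) (dil m a).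
Proof.
move=> an i lt_i; rewrite coef_dil; case: ifP => // /dvdnP[j e].
case: (posnP m) => m0; first by rewrite m0 mul0n ltn0 in lt_i.
by rewrite an //; move: lt_i; rewrite e mulnK // mulnC ltn_pmul2l.
Qed.

(** The substitution of c q for q. For c running through the l-th roots of unity it gives the
    conjugates of a over the series in q^l. *)
Definition tw (c : k) a : fps k := Fps (fun n => c ^+ n * a@_n).

Lemma coef_tw (c : k) a n : (tw c a)@_n = c ^+ n * a@_n. Proof. by []. Qed.

Fact tw_zmod (c : k) : zmod_morphism (tw c).
Proof. by move=> a b; apply/fpsP => n; rewrite fcoefB /= mulrBr. Qed.
Fact tw_monoid (c : k) : monoid_morphism (tw c).
Proof.
split=> [|a b]; apply/fpsP => n; first by case: n => [|n] /=; rewrite ?mulr1 ?mulr0.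
rewrite /= mulr_sumr; apply: eq_bigr => -[i /= lt_i] _.
by rewrite mulrACA -exprD subnKC.
Qed.
HB.instance Definition _ (c : k) := GRing.isZmodMorphism.Build _ _ (tw c) (tw_zmod c).
HB.instance Definition _ (c : k) := GRing.isMonoidMorphism.Build _ _ (tw c) (tw_monoid c).

Definition res l a : fps k := Fps (fun n => if (l %| n)%N then a@_n else 0).

(** Orthogonality of characters: the sum of z^(i n) over i is l when l divides n. Otherwise its
    product with z^n - 1 telescopes to zero. *)
Lemma sum_tw l (z : k) a : l.-primitive_root z ->
  \sum_(i < l) tw (z ^+ i) a = l%:R * res l a.
Proof.
move=> prim_z; apply/fpsP => n; rewrite fcoef_sum mulr_natl fcoefMn /=.
rewrite -mulr_suml; under eq_bigr => i _ do rewrite exprAC.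
case: ifP => [dv|ndv].
  have /eqP-> : z ^+ n == 1 by rewrite -(prim_order_dvd prim_z).
  by under eq_bigr do rewrite expr1n; rewrite sumr_const card_ord mulr_natl.
have zn1 : z ^+ n != 1 by rewrite -(prim_order_dvd prim_z) ndv.
rewrite mul0rn; apply/eqP; rewrite mulf_eq0 -(inj_eq (mulfI (_ : z ^+ n - 1 != 0))) ?subr_eq0 //.
by rewrite mulr0 -subrX1 exprAC (prim_expr_order prim_z) expr1n subrr eqxx.
Qed.

End SeriesRing.

#[global] Hint Resolve eqm_refl : core.

(** * Parity by involutions, and the form a^2 + 3 b^2 *)

(** The points moved by f fall into pairs; the induction removes one pair {x, f x} at a time. *)
Lemma odd_card_invol (T : finType) (S : {set T}) (f : T -> T) :
    {in S, forall x, f x \in S} -> {in S, involutive f} ->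
  odd #|S| = odd #|[set x in S | f x == x]|.
Proof.
have [n] := ubnP #|S|; elim: n S => // n IHn S le_Sn fS ffS.
case: (set_0Vmem [set x in S | f x != x]) => [S0 | [x]].
  congr (odd #|pred_of_set _|); apply/setP => x; rewrite inE.
  case Sx: (x \in S) => //=; apply/esym.
  by move/setP/(_ x): S0; rewrite !inE Sx => /negbFE.
rewrite inE => /andP[Sx ne_fx].
have Sfx := fS x Sx; have fxS : f x \in S :\ x by rewrite !inE ne_fx.
rewrite (cardsD1 x) Sx (cardsD1 (f x)) fxS /= negbK (IHn (S :\ x :\ f x)).
- congr (odd #|pred_of_set _|); apply/setP => y; rewrite !inE.
  case Sy: (y \in S); rewrite ?andbF //= !andbT.
  case: eqP => [->|_] /=; first by rewrite (ffS x Sx) [x == _]eq_sym (negPf ne_fx).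
  by case: eqP => [->|_] //=; rewrite (negPf ne_fx).
- by move: le_Sn; rewrite (cardsD1 x) Sx (cardsD1 (f x)) fxS /=; lia.
- move=> y; rewrite !inE => /and3P[ne_yfx ne_yx Sy]; rewrite fS // andbT.
  apply/andP; split; first by apply: contraNneq ne_yx => e; rewrite -(ffS y Sy) e ffS.
  by apply: contraNneq ne_yfx => <-; rewrite ffS.
by move=> y; rewrite !inE => /and3P[_ _ Sy]; apply: ffS.
Qed.

(* Conjugation of (e + c sqrt(-3)), where, up to the signs of a and b,
   a + b sqrt(-3) = (1 - sqrt(-3)) (e + c sqrt(-3)). *)
Definition refl3 (u : nat * nat) : nat * nat :=
  let: (a, b) := u in
  if a == b %[mod 4] then ((3 * b - a + (a - 3 * b))./2, (a + b)./2)
  else ((3 * b + a)./2, ((a - b) + (b - a))./2).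

(** The first branch fixes exactly the pairs a = b, the second exactly the pairs a = 3 b. As b is
    odd, a = 3 b never satisfies the congruence modulo 4 that selects the first branch. *)
Lemma refl3P a b (u := refl3 (a, b)) : odd a -> odd b ->
  [/\ odd u.1, odd u.2, u.1 ^ 2 + 3 * u.2 ^ 2 = a ^ 2 + 3 * b ^ 2,
      refl3 u = (a, b) & (u == (a, b)) = (a == b) || (a == 3 * b)].
Proof.
move=> odd_a odd_b; rewrite /u /refl3 -pair_eqE /=.
have [ab|ab] := boolP (a == b %[mod 4]).
  (* The sum of the two truncated differences is an absolute value. Fixing its sign makes one of
     them zero and leaves linear relations between a, b and the new pair. *)
  have [le|lt] := leqP a (3 * b).
    have -> : a - 3 * b = 0 by lia.
    rewrite addn0; set c := (3 * b - a)./2; set d := (a + b)./2.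
    have e1 : a + b = 2 * d by rewrite /d; lia.
    have e2 : c + d = 2 * b by rewrite /c /d; lia.
    split=> /=; try by rewrite /c /d; lia.
    by case: ifP => h; congr pair; lia.
  have -> : 3 * b - a = 0 by lia.
  rewrite add0n; set c := (a - 3 * b)./2; set d := (a + b)./2.
  have e1 : a + b = 2 * d by rewrite /d; lia.
  have e2 : d = 2 * b + c by rewrite /c /d; lia.
  split=> /=; try by rewrite /c /d; lia.
  by case: ifP => h; congr pair; lia.
have [le|lt] := leqP a b.
  have -> : a - b = 0 by lia.
  rewrite add0n; set c := (3 * b + a)./2; set d := (b - a)./2.
  have e1 : b = 2 * d + a by rewrite /d; lia.
  have e2 : c + d = 2 * b by rewrite /c /d; lia.
  split=> /=; try by rewrite /c /d; lia.
  by case: ifP => h; congr pair; lia.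
have -> : b - a = 0 by lia.
rewrite addn0; set c := (3 * b + a)./2; set d := (a - b)./2.
have e1 : a = 2 * d + b by rewrite /d; lia.
have e2 : c = 2 * b + d by rewrite /c /d; lia.
split=> /=; try by rewrite /c /d; lia.
by case: ifP => h; congr pair; lia.
Qed.

(** * Characteristic 2 and theta series *)

Section CharTwo.
Local Open Scope ring_scope.
Variable k : fieldType.
Hypothesis char2 : 2%N \in [pchar k].
Implicit Types a b c : fps k.

Lemma natr_odd n : n%:R = (odd n)%:R :> k.
Proof. by rewrite -[n in LHS]odd_double_half natrD -mul2n natrM (pcharf0 char2) mul0r addr0. Qed.

Lemma natr_eq_odd m n : odd m = odd n -> m%:R = n%:R :> k.
Proof. by rewrite natr_odd [n%:R]natr_odd => ->. Qed.

Lemma fps_pchar2 : 2%N \in [pchar (fps k)].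
Proof.
rewrite inE /=; apply/eqP/fpsP => n.
by rewrite fcoef_natr (pcharf0 char2) mul0rn.
Qed.

Lemma addaa a : a + a = 0. Proof. exact: addrr_pchar2 fps_pchar2 a. Qed.
Lemma oppa a : - a = a. Proof. exact: oppr_pchar2 fps_pchar2 a. Qed.
Lemma suba a b : a - b = a + b. Proof. by rewrite oppa. Qed.
Lemma addKa a b : a + b + b = a. Proof. by rewrite -addrA addaa addr0. Qed.
Lemma eq_adda a b : (a + b = 0) <-> (a = b).
Proof. by split=> [/eqP|->]; rewrite ?addaa // addr_eq0 oppa => /eqP. Qed.
Lemma sqrD_char2 a b : (a + b) ^+ 2 = a ^+ 2 + b ^+ 2.
Proof. by rewrite sqrrD mulr2n addaa addr0. Qed.
Lemma exp4D_char2 a b : (a + b) ^+ 4 = a ^+ 4 + b ^+ 4.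
Proof. by rewrite !(exprM _ 2 2) !sqrD_char2. Qed.

Lemma fps_natr_odd n : n%:R = (odd n)%:R :> fps k.
Proof. by rewrite -[n in LHS]odd_double_half natrD -mul2n natrM (pcharf0 fps_pchar2) mul0r addr0. Qed.

(** The coefficients lie in the prime field, expressed as being fixed by Frobenius. *)
Definition isF2 a := forall n, a@_n ^+ 2 = a@_n.

Lemma poly_sqr_coef (q : {poly k}) n :
  (q ^+ 2)`_n = if (2 %| n)%N then q`_(n %/ 2) ^+ 2 else 0.
Proof.
have cp : 2%N \in [pchar {poly k}] by rewrite pchar_poly.
elim/poly_ind: q n => [|q c IHq] n.
  by rewrite expr0n !coef0 expr0n; case: ifP.
rewrite sqrrD mulr2n addrr_pchar2 // addr0 exprMn -polyC_exp coefD coefC coefMXn IHq.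
case: n => [|[|n]] /=; first by rewrite add0r div0n coefD coefMX coefC add0r.
  by rewrite addr0.
rewrite addr0 subn2 /= -(addn2 n) dvdn_addl // divnDr // divnn /= addn1.
by rewrite coefD coefMX coefC addr0.
Qed.

(** Squaring is additive and fixes the coefficients, hence only doubles the exponents. *)
Lemma frobenius_F2 a : isF2 a -> a ^+ 2 = dil 2 a.
Proof.
move=> aF; apply/fpsP => n; rewrite expr2 (coef_mul_trunc _ _ (ltnSn n)) -expr2.
rewrite poly_sqr_coef coef_dil; case: ifP => // _.
by rewrite coef_trunc ?aF // ltnS leq_div.
Qed.

Lemma isF2_dil m a : isF2 a -> isF2 (dil m a).
Proof. by move=> aF n; rewrite coef_dil; case: ifP; rewrite ?aF ?expr0n. Qed.

Lemma isF2_natr n : (n%:R : k) ^+ 2 = n%:R.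
Proof. by rewrite natr_odd; case: odd; rewrite ?expr1n ?expr0n. Qed.

Lemma isF2D a b : isF2 a -> isF2 b -> isF2 (a + b).
Proof. by move=> aF bF n; rewrite fcoefD sqrrD mulr2n addrr_pchar2 // addr0 aF bF. Qed.

Lemma isF2M a b : isF2 a -> isF2 b -> isF2 (a * b).
Proof.
move=> aF bF n; rewrite fcoefM; elim/big_ind: _ => [|x y ex ey|i _].
- by rewrite expr0n.
- by rewrite sqrrD mulr2n addrr_pchar2 // addr0 ex ey.
- by rewrite exprMn aF bF.
Qed.

Lemma isF2_1 : isF2 1.
Proof. by move=> n; rewrite fcoef1 isF2_natr. Qed.

Lemma isF2_tX : isF2 (tX k).
Proof. by move=> n; rewrite isF2_natr. Qed.

Lemma isF2X a m : isF2 a -> isF2 (a ^+ m).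
Proof.
move=> aF; elim: m => [|m IHm]; first exact: isF2_1.
by rewrite exprS; apply: isF2M.
Qed.

(** Stands for the sum of q^(e a) over all a with [P a]. Cutting the range at a <= n loses nothing
    when i <= e i for all i, which the lemmas on coefficients assume. *)
Definition theta (P : pred nat) (e : nat -> nat) : fps k :=
  Fps (fun n => \sum_(a < n.+1) (P a && (e a == n))%:R).

Lemma isF2_theta P e : isF2 (theta P e).
Proof. by move=> n; rewrite /= -natr_sum isF2_natr. Qed.

Lemma coef_theta P e n N : (forall i, i <= e i)%N -> (n < N)%N ->
  (theta P e)@_n = \sum_(a < N) (P a && (e a == n))%:R.
Proof.
move=> le_e lt_nN; rewrite /= (big_ord_widen N (fun i => (P i && (e i == n))%:R)) //.
rewrite [RHS](bigID (fun i : 'I_N => (i < n.+1)%N)) /= [X in _ + X]big1 ?addr0 // => a.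
rewrite -leqNgt => lt_na; rewrite (gtn_eqF _) ?andbF //.
exact: leq_trans (le_e a).
Qed.

Lemma dil_theta m P e : (0 < m)%N -> (forall i, i <= e i)%N ->
  dil m (theta P e) = theta P (fun i => m * e i)%N.
Proof.
move=> m_gt0 le_e; apply/fpsP => n.
rewrite coef_dil; case: ifP => [/dvdnP[j ->]|ndv].
  rewrite mulnK // (coef_theta _ le_e (_ : j < (j * m).+1))%N; last by rewrite ltnS leq_pmulr.
  by apply: eq_bigr => a _; rewrite -(eqn_pmul2l m_gt0); congr (_ && (_ == _))%:R; lia.
rewrite /= big1 // => a _; case: eqP => [e1|]; rewrite ?andbF //.
by rewrite -e1 dvdn_mulr in ndv.
Qed.

Lemma coef_thetaM P e Q g n : (forall i, i <= e i)%N -> (forall i, i <= g i)%N ->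
  (theta P e * theta Q g)@_n =
  \sum_(a < n.+1) \sum_(b < n.+1) (P a && Q b && (e a + g b == n)%N)%:R.
Proof.
move=> le_e le_g; rewrite fcoefM.
transitivity (\sum_(i < n.+1) \sum_(a < n.+1) \sum_(b < n.+1)
    ((P a && (e a == i)) && (Q b && (g b == n - i)%N))%:R : k).
  apply: eq_bigr => i _; rewrite (coef_theta _ le_e (_ : i < n.+1)%N) //.
  rewrite (coef_theta _ le_g (_ : n - i < n.+1)%N) ?ltnS ?leq_subr // mulr_suml.
  apply: eq_bigr => a _; rewrite mulr_sumr; apply: eq_bigr => b _.
  by rewrite -natrM mulnb.
rewrite exchange_big /=; apply: eq_bigr => a _.
rewrite exchange_big /=; apply: eq_bigr => b _.
have [le_an|lt_na] := leqP (e a) n; last first.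
  rewrite big1 => [|i _]; first by rewrite (gtn_eqF (_ : n < _)%N) ?andbF // ltn_addr.
  by rewrite (gtn_eqF (_ : i < _)%N) ?andbF // (leq_ltn_trans _ lt_na) // -ltnS.
rewrite (bigD1 (Ordinal (_ : e a < n.+1)%N)) //= eqxx andbT.
rewrite big1 ?addr0 => [|i]; last first.
  by rewrite -val_eqE /= eq_sym => /negPf->; rewrite andbF.
by rewrite andbA -(eqn_add2l (e a)) subnKC.
Qed.

Definition psi : fps k := theta odd (fun i => i ^ 2)%N.

Lemma leq_self_sqr (a : nat) : (a <= a ^ 2)%N. Proof. by case: a => // a; rewrite leq_pmulr. Qed.
Lemma leq_mul_sqr (m a : nat) : (0 < m)%N -> (a <= m * a ^ 2)%N.
Proof. by move=> m_gt0; rewrite (leq_trans (leq_self_sqr a)) // leq_pmull. Qed.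

(** By Frobenius the left side is psi(q^4) + psi(q^12). The coefficient of q^n on the right counts,
    modulo 2, the odd pairs with a^2 + 3 b^2 = n. The involution [refl3] reduces this count to its
    fixed points: a = b, where n = 4 b^2, and a = 3 b, where n = 12 b^2. *)
Lemma psi_base : psi ^+ 4 + (dil 3 psi) ^+ 4 = psi * dil 3 psi.
Proof.
have F4 a : isF2 a -> a ^+ 4 = dil 4 a.
  move=> aF; rewrite (exprM _ 2 2) !frobenius_F2 ?dil_dil //; exact: isF2_dil.
rewrite !F4; try exact/isF2_dil/isF2_theta; last exact: isF2_theta.
rewrite dil_dil // /psi !dil_theta //; try exact: leq_self_sqr.
apply/fpsP => n; rewrite coef_thetaM; try by move=> a; rewrite ?leq_mul_sqr ?leq_self_sqr.
rewrite pair_big /= -!natr_sum -natrD; apply: natr_eq_odd.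
pose T := ('I_n.+1 * 'I_n.+1)%type.
pose S := [set u : T | odd u.1 && odd u.2 && (u.1 ^ 2 + 3 * u.2 ^ 2 == n)]%N.
pose nat2 (u : T) : nat * nat := (val u.1, val u.2).
(* The form takes the same value n on the reflected pair, so its entries are at most n and [inord]
   is faithful on S. *)
pose r (u : T) : T := let v := refl3 (nat2 u) in (inord v.1, inord v.2).
have rE u : u \in S -> nat2 (r u) = refl3 (nat2 u).
  rewrite inE => /andP[/andP[o1 o2] /eqP eu].
  case: (refl3P o1 o2); rewrite /nat2 /r; case: (refl3 _) => c d /= _ _ e _ _.
  have bnd m x y : (0 < m)%N -> (m * x ^ 2 + y = n)%N -> (x < n.+1)%N.
    by move=> m0 <-; rewrite ltnS (leq_trans (leq_mul_sqr x m0)) ?leq_addr.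
  by rewrite !inordK //; [apply: (bnd 3%N _ (c ^ 2)%N) | apply: (bnd 1%N _ (3 * d ^ 2)%N)]; lia.
have nat2_inj : injective nat2 by move=> [a b] [c d] [] /val_inj-> /val_inj->.
transitivity (odd #|S|); last first.
  congr odd; rewrite -sum1_card [LHS]big_mkcond /=; apply: eq_bigr => u _.
  by rewrite inE; case: ifP.
have rS u : u \in S -> r u \in S.
  move=> Su; have := rE u Su; move: Su; rewrite !inE.
  move=> /andP[/andP[o1 o2] /eqP eu]; case: (refl3P o1 o2) => p1 p2 ep _ _ e.
  by rewrite (congr1 fst e : val (r u).1 = _) (congr1 snd e : val (r u).2 = _) p1 p2 ep eu eqxx.
rewrite (odd_card_invol (f := r)) // => [|u Su]; last first.
  apply: nat2_inj; rewrite rE ?rS // rE //; move: Su; rewrite inE => /andP[/andP[o1 o2] _].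
  by case: (refl3P o1 o2).
have -> : [set u in S | r u == u] =
    [set u in S | (val u.1 == val u.2) || (val u.1 == 3 * val u.2)]%N.
  apply/setP => u; rewrite [LHS]inE [RHS]inE; case Su: (u \in S) => //=.
  rewrite -(inj_eq nat2_inj) rE //; move: Su; rewrite inE => /andP[/andP[o1 o2] _].
  by case: (refl3P o1 o2).
congr odd; set S' := [set u in S | _].
transitivity (\sum_(a < n.+1) \sum_(b < n.+1) ((a, b) \in S'))%N; last first.
  rewrite -sum1_card [RHS]big_mkcond pair_big /=.
  by apply: eq_bigr => -[a b] _ /=; case: (_ \in _).
rewrite exchange_big -big_split /=; apply: eq_bigr => b _.
(* For fixed b, each of the two fixed lines contains at most one a. The lines are disjoint because b
   is odd, hence nonzero. *)
transitivity (\sum_(a < n.+1) ((odd b && (4 * b ^ 2 == n) && (val a == val b)) +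
   (odd b && (4 * 3 * b ^ 2 == n) && (val a == 3 * b))))%N.
  rewrite big_split /=; congr (_ + _)%N.
    rewrite (bigD1 b) //= eqxx andbT big1 ?addn0 // => a.
    by rewrite -val_eqE /= => /negPf->; rewrite andbF.
  case: (boolP (odd b && _)) => [/andP[ob /eqP eb]|_]; last by rewrite big1.
  have lt : (3 * b < n.+1)%N by move: eb; nia.
  rewrite (bigD1 (Ordinal lt)) //= eqxx big1 ?addn0 // => a.
  by rewrite -val_eqE /= => /negPf->.
apply: eq_bigr => a _; rewrite !inE /=.
case ob : (odd b); rewrite ?andbF ?andbT //=.
case: (eqVneq (val a) (val b)) => [e|ne].
  rewrite e ob !andbT /= [(_ == 3 * _)%N](_ : _ = false) ?andbF ?addn0; [by [] | by lia].
rewrite andbF /= add0n; case: (eqVneq (val a) (3 * b)%N) => [e|_]; last by rewrite !andbF.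
by rewrite e oddM ob !andbT /= expnMn -mulnDl; case: eqP.
Qed.

End CharTwo.

(** * Modular equations *)

Section Sturm.
Local Open Scope ring_scope.
Variable k : fieldType.
Implicit Types (a b x y : fps k) (V : nat -> fps k -> Prop).

(** A ring of series filtered by degree: [V n a] says that a has degree at most n. The last field is
    a dimension bound over F_2, stated as a bound on the number of elements. *)
Record filtration V (d : nat) : Prop := Filtration {
  filt0 : forall n, V n 0;
  filt1 : V 0%N 1;
  filtD : forall n a b, V n a -> V n b -> V n (a + b);
  filtW : forall m n a, (m <= n)%N -> V m a -> V n a;
  filtM : forall m n a b, V m a -> V n b -> V (m + n)%N (a * b);
  filt_fin : forall n, exists2 s : seq (fps k),
    (size s <= 2 ^ (d * n.+1))%N & forall a, V n a -> a \in s }.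

Lemma filt_sum V d n (I : Type) (r : seq I) (P : pred I) (F : I -> fps k) :
  filtration V d -> (forall i, P i -> V n (F i)) -> V n (\sum_(i <- r | P i) F i).
Proof. by move=> fV VF; elim/big_ind: _ => //; [apply: (filt0 fV) | apply: (filtD fV)]. Qed.

Lemma filtX V d n m a : filtration V d -> V n a -> V (n * m)%N (a ^+ m).
Proof.
move=> fV Va; elim: m => [|m IHm]; first by rewrite muln0; apply: (filt1 fV).
by rewrite mulnS exprS; apply: (filtM fV).
Qed.

Definition Vpoly x n a :=
  exists c : nat -> bool, a = \sum_(i < n.+1) (c i)%:R * x ^+ i.

Lemma Vpoly_filtration x : 2%N \in [pchar k] -> filtration (Vpoly x) 1.
Proof.
move=> char2; have W m n a : (m <= n)%N -> Vpoly x m a -> Vpoly x n a.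
  move=> le_mn [c ->]; exists (fun i => (i < m.+1)%N && c i).
  rewrite (big_ord_widen n.+1 (fun i => (c i)%:R * x ^+ i)) // big_mkcond /=.
  by apply: eq_bigr => i _; case: ifP; rewrite ?mul0r.
have D n a b : Vpoly x n a -> Vpoly x n b -> Vpoly x n (a + b).
  move=> [c ->] [e ->]; exists (fun i => c i (+) e i); rewrite -big_split /=.
  apply: eq_bigr => i _; rewrite -mulrDl; congr (_ * _).
  by case: (c i); case: (e i); rewrite /= ?addr0 ?add0r // addaa.
have z n : Vpoly x n 0 by exists (fun=> false); rewrite big1 // => i _; rewrite mul0r.
have X m n a : Vpoly x n a -> Vpoly x (m + n)%N (x ^+ m * a).
  move=> [c ->]; exists (fun i => (m <= i)%N && c (i - m)%N).
  rewrite -addnS big_split_ord /= [X in _ = X + _]big1 ?add0r => [|i _]; last first.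
    by rewrite leqNgt ltn_ord mul0r.
  rewrite mulr_sumr; apply: eq_bigr => i _.
  by rewrite leq_addr addKn exprD mulrCA.
split=> //.
- by exists (fun=> true); rewrite big_ord1 mul1r.
- move=> m n a b [c ->] Vb; rewrite mulr_suml.
  elim/big_ind: _ => [||i _] //; first exact: D.
  case: (c i); rewrite ?mul0r // mul1r; apply: W (X i n b Vb).
  by rewrite leq_add2r -ltnS.
move=> n; pose F (c : {ffun 'I_n.+1 -> bool}) := \sum_(i < n.+1) (c i)%:R * x ^+ i : fps k.
exists (map F (enum {ffun 'I_n.+1 -> bool})).
  by rewrite size_map -cardE card_ffun card_bool card_ord mul1n.
move=> a [c ->]; apply/mapP; exists [ffun i : 'I_n.+1 => c i].
  by rewrite mem_enum.
by apply: eq_bigr => i _; rewrite ffunE.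
Qed.

Lemma Vpoly_gen x : Vpoly x 1 x.
Proof. by exists (eq_op 1%N); rewrite !big_ord_recl big_ord0 mul0r mul1r add0r addr0. Qed.

(** Combinations of 1, y, ..., y^(m-1) over the filtered ring, with y placed in degree 1. *)
Definition Vext V m y n a :=
  exists2 f : nat -> fps k, forall j, (j <= n)%N -> V (n - j)%N (f j) &
    a = \sum_(j < m | (j <= n)%N) f j * y ^+ j.

(** The relation for y^m has weighted degree m, so reducing powers of y by it does not raise the
    degree. An element of degree n is given by m elements of [V n], which multiplies the dimension
    bound by m. *)
Lemma Vext_filtration V d m y (c : nat -> fps k) : (0 < m)%N ->
    filtration V d -> (forall j, (j < m)%N -> V (m - j)%N (c j)) ->
    y ^+ m = \sum_(j < m) c j * y ^+ j ->
  [/\ filtration (Vext V m y) (d * m),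
      forall n a, V n a -> Vext V m y n a & Vext V m y 1 y].
Proof.
move=> m_gt0 fV Vc yE; set U := Vext V m y.
have U0 n : U n 0.
  by exists (fun=> 0) => [j _|]; [exact: (filt0 fV) | rewrite big1 // => j _; rewrite mul0r].
have UD n a b : U n a -> U n b -> U n (a + b).
  move=> [f Vf ->] [g Vg ->]; exists (fun j => f j + g j) => [j le_j|].
    exact/(filtD fV)/Vg/le_j/Vf.
  by rewrite -big_split /=; apply: eq_bigr => j _; rewrite mulrDl.
have Usum n (I : Type) (r : seq I) (P : pred I) (F : I -> fps k) :
    (forall i, P i -> U n (F i)) -> U n (\sum_(i <- r | P i) F i).
  by move=> UF; elim/big_ind: _ => //; apply: UD.
have UW n p a : (n <= p)%N -> U n a -> U p a.
  move=> le_np [f Vf ->]; exists (fun j => if (j <= n)%N then f j else 0) => [j le_j|].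
    by case: ifP => [le_jn|_]; [apply/(filtW fV)/Vf/le_jn; lia | apply: (filt0 fV)].
  rewrite big_mkcond [RHS]big_mkcond /=; apply: eq_bigr => j _.
  case: ifP => le_jn; first by rewrite (leq_trans le_jn).
  by case: ifP; rewrite ?mul0r.
have Umon n p a j : (j < m)%N -> (p + j <= n)%N -> V p a -> U n (a * y ^+ j).
  move=> lt_jm le_n Va; apply: (UW (p + j)%N) => //.
  exists (fun i => if i == j then a else 0) => [i le_i|].
    by case: eqP => [->|_]; [rewrite addnK | apply: (filt0 fV)].
  rewrite (bigD1 (Ordinal lt_jm)) /= ?leq_addl // eqxx big1 ?addr0 // => i /andP[_].
  by rewrite -val_eqE /= => /negPf->; rewrite mul0r.
have Uy n a : U n a -> U n.+1 (y * a).
  move=> [f Vf ->]; rewrite mulr_sumr; apply: (Usum) => j le_jn.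
  rewrite mulrCA -exprS; have [lt_jm|ge_jm] := ltnP j.+1 m.
    by apply: (Umon n.+1 (n - j)%N) => //; [lia | apply: Vf].
  have -> : j.+1 = m by apply/eqP; rewrite eqn_leq ge_jm ltn_ord.
  rewrite yE mulr_sumr; apply: (Usum) => i _; rewrite mulrA.
  apply: (Umon n.+1 (n - j + (m - i))%N) => //; first by have := ltn_ord i; lia.
  exact/(filtM fV)/Vc/ltn_ord/Vf.
have UV n p a b : V n a -> U p b -> U (n + p)%N (a * b).
  move=> Va [f Vf ->]; rewrite mulr_sumr; apply: (Usum) => j le_jp; rewrite mulrA.
  apply: (Umon _ (n + (p - j))%N) => //; first by lia.
  exact/(filtM fV)/Vf.
have UyX n a j : U n a -> U (j + n)%N (y ^+ j * a).
  by move=> Ua; elim: j => [|j IHj]; rewrite ?mul1r // exprS -mulrA; apply: Uy.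
have VU n a : V n a -> U n a.
  by move=> Va; rewrite -[a]mulr1 -(expr0 y); apply: (Umon n n) => //; rewrite addn0.
split=> //; last by rewrite -[y]mulr1; apply/Uy/VU/(filt1 fV).
split=> //.
- exact/VU/(filt1 fV).
- move=> n p a b [f Vf ->] Ub; rewrite mulr_suml; apply: (Usum) => j le_jn.
  rewrite -mulrA; have -> : (n + p = n - j + (j + p))%N by lia.
  exact/UV/UyX/Ub/Vf.
move=> n; have [s le_s Vs] := filt_fin fV n.
have s0 : 0 \in s by apply/Vs/(filt0 fV).
pose F (g : {ffun 'I_m -> seq_sub (undup s)}) : fps k :=
  \sum_(j < m | (j <= n)%N) val (g j) * y ^+ j.
exists (map F (enum {ffun 'I_m -> seq_sub (undup s)})).
  rewrite size_map -cardE card_ffun card_ord card_seq_sub ?undup_uniq //.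
  rewrite mulnAC expnM leq_exp2r //; exact: leq_trans (size_undup s) le_s.
move=> a [f Vf ->]; apply/mapP.
have fs (j : 'I_m) : (if (j <= n)%N then f j else 0) \in undup s.
  rewrite mem_undup; case: ifP => // le_jn; apply/Vs/(filtW fV)/Vf/le_jn.
  exact: leq_subr.
exists [ffun j => SeqSub (fs j)]; first by rewrite mem_enum.
by apply: eq_bigr => j le_jn; rewrite ffunE /= le_jn.
Qed.

(* The products x^a h^r (a < ord h) have pairwise distinct orders, so the
   2^(o (R + 1)) subset sums of those with r <= R are distinct. *)
Lemma filtration_ord V d x e h o : filtration V d ->
    x@_0 = 0 -> x@_1 = 1 -> V 1%N x -> V e h -> ordge o h -> h@_o != 0 ->
  (o <= d * e)%N.
Proof.
move=> fV x0 x1 Vx Vh oh h_nz; rewrite leqNgt; apply/negP => lt_o.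
have o_gt0 : (0 < o)%N by apply: leq_ltn_trans lt_o.
(* All products considered have degree at most e R + o - 1, so the counting bound reads o (R + 1) <=
   d (e R + o). For o > d e the left side exceeds the right by at least R + o - d o, which is
   positive for R = d o. *)
pose R := (d * o)%N; pose K := (o * R.+1)%N.
pose u i : fps k := x ^+ (i %% o) * h ^+ (i %/ o).
have ordx : ordge 1 x by case.
have ord_u i : ordge i (u i).
  rewrite {1}(divn_eq i o) addnC mulnC; apply: ordgeM; last exact: ordgeX.
  by rewrite -[X in ordge X]mul1n; apply: ordgeX.
have u_nz i : (u i)@_i != 0.
  rewrite {2}(divn_eq i o) addnC mulnC coefM_ord; first last.
  - exact: ordgeX.
  - by rewrite -[X in ordge X]mul1n; apply: ordgeX.
  rewrite -[X in _@_X * _]mul1n !coefX_ord // x1 expr1n mul1r.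
  exact: expf_neq0.
have uV (i : 'I_K) : V (e * R + o.-1)%N (u i).
  apply: (filtW fV (m := (1 * (i %% o) + e * (i %/ o))%N)); last first.
    by apply: (filtM fV); apply: filtX fV _.
  rewrite mul1n addnC leq_add ?leq_mul2l //; last by rewrite -ltnS prednK ?ltn_mod.
  by rewrite -ltnS ltn_divLR // mulnC ltn_ord orbT.
clearbody u; pose E (c : {ffun 'I_K -> bool}) : fps k := \sum_(i < K | c i) u i.
(* Since u j has order exactly j, the coefficient at i involves only the choices at j <= i. The
   choices can thus be recovered one after another. *)
have coefE (f : {ffun 'I_K -> bool}) (i : 'I_K) :
    (E f)@_i = \sum_(j < K | f j && (j < i)%N) (u j)@_i + (f i)%:R * (u i)@_i.
  rewrite fcoef_sum (bigID (fun j : 'I_K => (j < i)%N)) /=; congr (_ + _).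
  transitivity (\sum_(j < K | f j && (j == i)) (u j)@_i).
    rewrite big_mkcond [RHS]big_mkcond; apply: eq_bigr => j _ /=.
    case: (f j) => //=; case: ltngtP => [lt_ji|lt_ij|/val_inj ->]; rewrite ?eqxx //=.
    - by rewrite -val_eqE /= ltn_eqF.
    - by rewrite -val_eqE /= gtn_eqF // (ord_u j).
  case fi: (f i); last first.
    by rewrite mul0r big1 // => j /andP[fj /eqP ej]; rewrite -ej fj in fi.
  rewrite (big_pred1 i) => [|j /=]; first by rewrite mulr1n mul1r.
  by case: eqP => [->|]; rewrite ?andbF ?fi.
have E_inj : injective E.
  move=> c c' eqE; apply/ffunP => i; have [n] := ubnP (val i).
  elim: n i => // n IHn i le_in.
  have := congr1 (fun a => a@_i) eqE; rewrite !coefE.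
  rewrite (eq_bigl (fun j => c' j && (j < i)%N)) => [/addrI /(mulIf (u_nz i))|j].
    by case: (c i); case: (c' i) => // /eqP; rewrite ?oner_eq0 // eq_sym oner_eq0.
  case lt_ji: (j < i)%N; rewrite ?andbF // IHn //.
  exact: leq_trans lt_ji le_in.
have [s le_s Vs] := filt_fin fV (e * R + o.-1)%N.
have sE : {subset map E (enum {ffun 'I_K -> bool}) <= s}.
  move=> _ /mapP[c _ ->]; apply: Vs; rewrite /E; apply: (filt_sum _ fV) => i _.
  exact: uV.
have := leq_trans (uniq_leq_size _ sE) le_s.
rewrite map_inj_uniq ?enum_uniq // size_map -cardE card_ffun card_bool card_ord.
move/(_ isT); rewrite leq_exp2l // /K /R => le1; nia.
Qed.

End Sturm.

Section ModularEquation.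
Local Open Scope ring_scope.
Variable k : fieldType.
Implicit Types (a b x y z : fps k) (L : seq (nat * nat)).

(** F is a contraction for the adic topology, and the iterates of 0 converge coefficient by
    coefficient: the coefficient of index n is final after n + 1 steps. *)
Lemma fixed_point (F : fps k -> fps k) :
  (forall n a b, eqm n a b -> eqm n.+1 (F a) (F b)) -> exists a, F a = a.
Proof.
move=> Fc; have Fi m n : eqm n (iter (n + m) F 0) (iter n F 0).
  elim: n => [|n IHn]; first by move=> i.
  by rewrite addSn !iterS; apply: Fc.
pose s : fps k := Fps (fun n => (iter n.+1 F 0)@_n).
have sE n : eqm n s (iter n F 0).
  apply/eqmP => i lt_in; rewrite /s /= -iterS -(subnKC lt_in).
  by have /eqmP -> := Fi (n - i.+1)%N i.+1.
exists s; apply: eqm_eq => -[|n]; first by move=> i.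
exact: eqm_trans (Fc _ _ _ (sE n)) (eqm_sym (sE n.+1)).
Qed.

(** The cofactor of y - z is homogeneous of degree n in y and z. *)
Lemma ordge_subX l n y z m : ordge l y -> ordge l z -> ordge m (y - z) ->
  ordge (m + l * n) (y ^+ n.+1 - z ^+ n.+1).
Proof.
move=> ly lz lyz; rewrite subrXX; apply: ordgeM => //.
apply: ordge_sum => i _ _; have lt_i := ltn_ord i.
by rewrite (_ : l * n = l * (n.+1.-1 - i) + l * i)%N; [apply: ordgeM; exact: ordgeX | nia].
Qed.

Lemma ordge_coef_neq0 n r a : ordge n a -> a@_r != 0 -> (n <= r)%N.
Proof. by move=> na; apply: contraR; rewrite -ltnNge => /na ->. Qed.

(** [Vext_filtration] for a relation that is a sum of monomials in x and y; grouping them by the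
    exponent of y gives its coefficients. *)
Lemma Vext_monomials V d m L x y : (0 < m)%N -> filtration V d -> V 1%N x ->
    all (fun ab => (ab.2 < m) && (ab.1 + ab.2 <= m))%N L ->
    y ^+ m = \sum_(ab <- L) x ^+ ab.1 * y ^+ ab.2 ->
  [/\ filtration (Vext V m y) (d * m),
      forall n a, V n a -> Vext V m y n a & Vext V m y 1 y].
Proof.
move=> m_gt0 fV Vx /allP Lm yE.
apply: (Vext_filtration (c := fun j => \sum_(ab <- L | ab.2 == j) x ^+ ab.1)) => //.
- move=> j lt_jm; rewrite big_seq_cond; apply: (filt_sum _ fV) => ab /andP[/Lm/andP[_ le] /eqP e].
  apply: (filtW fV) (filtX ab.1 fV Vx).
  by rewrite mul1n -(leq_add2r j) subnK ?(ltnW lt_jm) // -e.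
rewrite yE; under [RHS]eq_bigr => j _ do rewrite mulr_suml.
rewrite (exchange_big_dep xpredT) //= !big_seq; apply: eq_bigr => ab /Lm/andP[lt _].
rewrite (big_pred1 (Ordinal lt)) // => j /=.
Qed.

Hypothesis char2 : 2%N \in [pchar k].

(** Covers the two known equations used below: c = p = 3 is the relation between psi(t^3) = eta^3
    and psi(t^9), and c = 1, p = 5 is the equation of level 5. *)
Definition base_eq c p (x y : fps k) := (x ^+ c) ^+ p.+1 + (y ^+ c) ^+ p.+1 + x ^+ c * y ^+ c.

(* Comparing the terms of lowest order shows that [y ^+ c] is determined by its
   leading term. *)
Lemma base_eq_uniq c p l y z : odd c -> odd p -> (1 < p)%N -> (0 < l)%N ->
    ordge l y -> y@_l = 1 -> ordge l.+1 (y - z) ->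
    base_eq c p y (dil p y) = 0 -> base_eq c p z (dil p z) = 0 ->
  y = z.
Proof.
move=> odd_c odd_p p_gt1 l_gt0 ly y1 lyz By Bz.
have lz : ordge l z.
  rewrite -[z](subKr y); apply: ordgeB => //; exact: ordgeW lyz.
have z1 : z@_l = 1 by rewrite -[z](subKr y) fcoefB y1 lyz ?subr0.
case: c odd_c By Bz => // c odd_c; rewrite /base_eq.
have p_gt0 : (0 < p)%N by apply: ltnW.
have dX a : dil p a ^+ c.+1 = dil p (a ^+ c.+1).
  by case: (p) p_gt0 => // q _; rewrite rmorphXn.
rewrite !dX => By Bz.
have lD : ordge (l.+1 + l * c) (y ^+ c.+1 - z ^+ c.+1) by apply: ordge_subX.
suff eqc : y ^+ c.+1 = z ^+ c.+1.
  (* The other factor is a sum of [c.+1] products with leading coefficient 1. This number is odd, so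
     the factor is not zero. *)
  have /eqP := eqc; rewrite -subr_eq0 subrXX mulf_eq0 subr_eq0.
  case/orP => [/eqP // | /eqP/(congr1 (fun a => a@_(l * c)))].
  rewrite fcoef_sum (eq_bigr (fun=> 1)) => [|i _].
    rewrite sumr_const card_ord natr_odd // odd_c => /eqP.
    by rewrite oner_eq0.
  have lt_i := ltn_ord i; rewrite (_ : l * c = l * (c.+1.-1 - i) + l * i)%N; last by nia.
  by rewrite coefM_ord ?coefX_ord ?y1 ?z1 ?expr1n ?mul1r //; exact: ordgeX.
have lA : ordge (l * c.+1) (y ^+ c.+1) by apply: ordgeX.
have lB : ordge (l * c.+1) (z ^+ c.+1) by apply: ordgeX.
have A1 : (y ^+ c.+1)@_(l * c.+1) = 1 by rewrite coefX_ord // y1 expr1n.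
move: (y ^+ c.+1) (z ^+ c.+1) lD lA lB A1 By Bz => A B lD lA lB A1 EA EB.
apply/eqP; rewrite -subr_eq0; apply: contraT => /ord_exists[r rD Dr].
have lt_r : (l * c.+1 < r)%N by have := ordge_coef_neq0 lD Dr; nia.
set e := (l * c.+1)%N in lt_r lA lB A1.
have dB : dil p A - dil p B = dil p (A - B) by rewrite dilB.
(* As p + 1 is even, the difference of powers is the square of a difference of powers. Its order is
   at least 2 r + e (p - 1), which exceeds r + p e because r > e. *)
have lP : ordge (r + p * e).+1 (A ^+ p.+1 - B ^+ p.+1).
  have -> : A ^+ p.+1 - B ^+ p.+1 = (A ^+ p.+1./2 - B ^+ p.+1./2) ^+ 2.
    rewrite !suba // sqrD_char2 // -!exprM; congr (_ ^+ _ + _ ^+ _); lia.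
  have -> : p.+1./2 = p./2.+1 by lia.
  apply: (ordgeW (m := ((r + e * p./2) * 2)%N)); first by nia.
  by apply: ordgeX; apply: ordge_subX.
have lP' : ordge (r + p * e).+1 (dil p A ^+ p.+1 - dil p B ^+ p.+1).
  have -> : dil p A ^+ p.+1 - dil p B ^+ p.+1 = dil p (A ^+ p.+1 - B ^+ p.+1).
    by case: (p) p_gt0 => // q _; rewrite rmorphB !rmorphXn.
  by apply: ordgeW (ordge_dil (m := p) lP); rewrite leq_pmull.
have : (A ^+ p.+1 + dil p A ^+ p.+1 + A * dil p A)
     - (B ^+ p.+1 + dil p B ^+ p.+1 + B * dil p B) = 0 by rewrite EA EB subrr.
have -> : (A ^+ p.+1 + dil p A ^+ p.+1 + A * dil p A)
     - (B ^+ p.+1 + dil p B ^+ p.+1 + B * dil p B) =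
  (A ^+ p.+1 - B ^+ p.+1) + (dil p A ^+ p.+1 - dil p B ^+ p.+1)
  + (A - B) * dil p A + B * (dil p A - dil p B) by ring.
(* At exponent r + p e only (A - B) A(t^p) contributes, with the coefficient of A - B at r. The last
   product has order at least e + p r > r + p e. *)
move/(congr1 (fun a => a@_(r + p * e))); rewrite dB 3!fcoefD lP // lP' //.
have -> : (B * dil p (A - B))@_(r + p * e) = 0.
  apply: (ordgeM lB (ordge_dil (m := p) rD)); nia.
rewrite coefM_ord //; last exact: ordge_dil.
by rewrite coef_dil_mul // A1 mulr1 !add0r addr0 => /eqP; rewrite (negPf Dr).
Qed.

(** L lists the exponents of the further monomials; modulo 2 their coefficients can be taken to be
    1. *)
Definition modeq (R : comNzRingType) n L (x y : R) :=
  x ^+ n + y ^+ n + x * y + \sum_(ab <- L) x ^+ ab.1 * y ^+ ab.2.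

Lemma rmorph_modeq (R S : comNzRingType) (f : {rmorphism R -> S}) n L (x y : R) :
  f (modeq n L x y) = modeq n L (f x) (f y).
Proof.
rewrite /modeq !rmorphD rmorphM !rmorphXn rmorph_sum; congr (_ + _).
by apply: eq_bigr => ab _; rewrite rmorphM !rmorphXn.
Qed.

Lemma dil_modeq p n L x y : (0 < p)%N ->
  dil p (modeq n L x y) = modeq n L (dil p x) (dil p y).
Proof. by case: p => // p _; rewrite rmorph_modeq. Qed.

(* The equation [modeq l.+1 L x Y = 0] has a root Y of order l, obtained as a
   fixed point. By the counting bound for the ring generated by x, [dil p x], Y
   and [dil p Y], the series [base_eq c p Y (dil p Y)] vanishes, so that
   Y = [dil l x] by uniqueness. *)
Theorem modular_equation c p l L x M : odd c -> odd p -> (1 < p)%N -> (1 < l)%N ->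
    x@_0 = 0 -> x@_1 = 1 -> base_eq c p x (dil p x) = 0 ->
    all (fun ab => [&& 0 < ab.2, ab.2 < l.+1, ab.1 + ab.2 <= l.+1
                     & l.+1 < ab.1 + l * ab.2])%N L ->
    ((c * p.+1) ^ 2 * l.+1 ^ 2 + 1 < M)%N ->
    ordge M (modeq l.+1 L x (dil l x)) ->
  modeq l.+1 L x (dil l x) = 0.
Proof.
move=> odd_c odd_p p_gt1 l_gt1 x0 x1 Bx /allP Lall lt_M Mx.
have c_gt0 : (0 < c)%N by case: (c) odd_c.
have p_gt0 : (0 < p)%N by apply: ltnW.
have l_gt0 : (0 < l)%N by apply: ltnW.
have x_ord : ordge 1 x by case.
set n := l.+1.
have lt_ln : (n < l * n)%N by rewrite -[X in (X < _)%N]mul1n ltn_pmul2r.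
(* The equation for Y = x^l s divided by x^n, solved for the term s that comes from x Y. The
   hypothesis on L makes all remaining exponents of x positive, hence the map is contracting. *)
have [s sE] : exists s, 1 + x ^+ (l * n - n) * s ^+ n
    + \sum_(ab <- L) x ^+ (ab.1 + l * ab.2 - n) * s ^+ ab.2 = s.
  apply: fixed_point => m a b mab.
  have xm e : (0 < e)%N -> forall i, eqm m.+1 (x ^+ e * a ^+ i) (x ^+ e * b ^+ i).
    move=> e_gt0 i; rewrite /eqm -mulrBr -add1n; apply: ordgeM; last exact: eqmX.
    by apply: ordgeW e_gt0 _; rewrite -[X in ordge X]mul1n; apply: ordgeX.
  apply: eqmD; first by apply: eqmD; [exact: eqm_refl | apply: xm; rewrite subn_gt0].
  by apply: eqm_sum => ab /Lall/and4P[_ _ _ lt] _; apply: xm; rewrite subn_gt0.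
pose y := x ^+ l * s; pose y' := dil l x.
have Py : modeq n L x y = 0.
  rewrite /modeq /y.
  have -> : x ^+ n + (x ^+ l * s) ^+ n + x * (x ^+ l * s) +
      \sum_(ab <- L) x ^+ ab.1 * (x ^+ l * s) ^+ ab.2 =
    x ^+ n * (1 + x ^+ (l * n - n) * s ^+ n
     + \sum_(ab <- L) x ^+ (ab.1 + l * ab.2 - n) * s ^+ ab.2 + s).
    have eA : x ^+ n * (x ^+ (l * n - n) * s ^+ n) = (x ^+ l * s) ^+ n.
      by rewrite mulrA -exprD subnKC ?(ltnW lt_ln) // exprMn -exprM.
    have eS : x ^+ n * s = x * (x ^+ l * s) by rewrite mulrA -exprS.
    have eB : x ^+ n * \sum_(ab <- L) x ^+ (ab.1 + l * ab.2 - n) * s ^+ ab.2 =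
        \sum_(ab <- L) x ^+ ab.1 * (x ^+ l * s) ^+ ab.2.
      rewrite mulr_sumr !big_seq; apply: eq_bigr => ab /Lall/and4P[_ _ _ lt].
      by rewrite mulrA -exprD subnKC ?(ltnW lt) // exprD exprMn -exprM mulrA.
    by rewrite 3!mulrDr mulr1 eA eS eB addrAC.
  by rewrite sE addaa // mulr0.
have s0 : s@_0 = 1.
  rewrite -sE !fcoefD fcoefM0 fcoefX0 x0 expr0n gtn_eqF ?subn_gt0 //.
  rewrite mul0r fcoef_sum big_seq big1 ?addr0 // => ab /Lall/and4P[_ _ _ lt].
  by rewrite fcoefM0 fcoefX0 x0 expr0n gtn_eqF ?subn_gt0 // mul0r.
have ly : ordge l y.
  by apply: ordgeMl; rewrite -[X in ordge X]mul1n; apply: ordgeX.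
have y1 : y@_l = 1.
  rewrite -[l]addn0 coefM_ord //; last by rewrite -[X in ordge X]mul1n; apply: ordgeX.
  by rewrite s0 mulr1 -[X in _@_X]mul1n coefX_ord // x1 expr1n.
have ly' : ordge l y' by rewrite -[X in ordge X]muln1; apply: ordge_dil.
have y'1 : y'@_l = 1 by rewrite -[X in _@_X]muln1 coef_dil_mul.
(* The difference of the two values of the equation is y - y' times a factor x + T, where T has
   order at least 2. That factor has order exactly 1, which costs one in precision. *)
have lyy' : ordge M.-1 (y - y').
  pose q m a b : fps k := \sum_(i < m) a ^+ (m.-1 - i) * b ^+ i.
  have q_ord m : ordge (l * m.-1) (q m y y').
    case: m => [|m]; first by rewrite /q big_ord0.
    apply: ordge_sum => i _ _; have lt_i := ltn_ord i.
    have -> : (l * m.+1.-1 = l * (m.+1.-1 - i) + l * i)%N by rewrite -mulnDr subnK.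
    by apply: ordgeM; exact: ordgeX.
  have E : modeq n L x y - modeq n L x y' =
      (y - y') * (x + (q n y y' + \sum_(ab <- L) x ^+ ab.1 * q ab.2 y y')).
    have qE m : (y - y') * q m y y' = y ^+ m - y' ^+ m by rewrite subrXX.
    have -> : (y - y') * (x + (q n y y' + \sum_(ab <- L) x ^+ ab.1 * q ab.2 y y')) =
        x * y - x * y' + (y ^+ n - y' ^+ n)
        + (\sum_(ab <- L) x ^+ ab.1 * y ^+ ab.2 - \sum_(ab <- L) x ^+ ab.1 * y' ^+ ab.2).
      rewrite !mulrDr qE addrA -sumrB mulr_sumr; congr (_ + _ + _).
        by rewrite mulrC mulrBr.
      by apply: eq_bigr => ab _; rewrite mulrCA qE mulrBr.
    by rewrite /modeq; ring.
  set T := q n y y' + _ in E.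
  have T2 : ordge 2 T.
    apply: ordgeD; first by apply: ordgeW (q_ord n); rewrite (leq_trans l_gt1) // leq_pmulr.
    apply: ordge_sum => -[a [|b]] /Lall/and4P[//= _ _ _ lt] _.
    apply: (ordgeW (m := (a + l * b)%N)); first by move: lt; rewrite mulnS; lia.
    by apply: ordgeM (q_ord b.+1); rewrite -[X in ordge X]mul1n; exact: ordgeX.
  have [->|] := eqVneq (y - y') 0; first exact: ordge0.
  case/ord_exists => r rD Dr; apply: (ordgeW _ rD).
  have : (modeq n L x y - modeq n L x y')@_(r + 1) != 0.
    have T1 : ordge 1 (x + T) by apply: ordgeD => //; apply: ordgeW T2.
    by rewrite E coefM_ord // [(x + T)@_1]fcoefD x1 T2 // addr0 mulr1.
  rewrite Py sub0r; move/(ordge_coef_neq0 (ordgeN Mx)); lia.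
have By' : base_eq c p y' (dil p y') = 0.
  have E : dil l (base_eq c p x (dil p x)) = base_eq c p y' (dil p y').
    rewrite /base_eq /y' [dil p (dil l x)]dil_dil // mulnC -dil_dil //.
    by case: (l) l_gt0 => // l' _; rewrite !(rmorphD, rmorphM, rmorphXn).
  by rewrite -E Bx; apply/fpsP => i; rewrite coef_dil; case: ifP.
suff By : base_eq c p y (dil p y) = 0.
  rewrite -/y' -(base_eq_uniq odd_c odd_p p_gt1 l_gt0 ly y1 _ By By') //.
  have le1 : (l.+1 <= (c * p.+1) ^ 2 * l.+1 ^ 2)%N.
    by apply: leq_trans (leq_self_sqr _) _; rewrite leq_pmull // expn_gt0 muln_gt0 c_gt0.
  by apply: ordgeW lyy'; move: lt_M le1; set e := (_ * _)%N; lia.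
(* m bounds the degree of [base_eq]. Adjoining x(t^p), Y and Y(t^p) in turn to F_2[x] multiplies the
   dimension bound by m, n and n. *)
set m := (c * p.+1)%N.
have le2c : (c + c <= m)%N by rewrite addnn -muln2 leq_pmul2l // ltnS.
have [f1 i1 V1] : [/\ filtration (Vext (Vpoly x) m (dil p x)) (1 * m),
      forall n a, Vpoly x n a -> Vext (Vpoly x) m (dil p x) n a
    & Vext (Vpoly x) m (dil p x) 1 (dil p x)].
  apply: (@Vext_monomials _ _ _ [:: (m, 0); (c, c)] x) => //.
  - by rewrite muln_gt0 c_gt0.
  - exact: Vpoly_filtration char2.
  - exact: Vpoly_gen.
  - rewrite /= addn0 leqnn muln_gt0 c_gt0 le2c !andbT /=.
    by apply: leq_trans le2c; rewrite -addn1 leq_add2l.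
  rewrite !big_cons big_nil /= expr0 mulr1 addr0.
  by apply/eqP; rewrite -subr_eq0 suba // !exprM addrCA addrA; apply/eqP.
set V1_ := Vext _ _ _ in f1 i1 V1.
have root_ext V d z w : filtration V d -> V 1%N z -> modeq n L z w = 0 ->
  [/\ filtration (Vext V n w) (d * n),
      forall n' a, V n' a -> Vext V n w n' a & Vext V n w 1 w].
  move=> fV Vz Pzw; apply: (@Vext_monomials _ _ _ [:: (n, 0), (1, 1) & L] z) => //.
    rewrite /= addn0 leqnn /=; apply/andP; split; first by rewrite /n; lia.
    by apply/allP => ab /Lall/and4P[_ -> -> _].
  rewrite !big_cons /= expr0 mulr1 expr1.
  by apply/eqP; rewrite -subr_eq0 suba //; apply/eqP; rewrite -[RHS]Pzw /modeq; ring.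
have Vx : V1_ 1%N x by apply/i1/Vpoly_gen.
have [f2 i2 V2] := root_ext _ _ _ _ f1 Vx Py.
have Pdy : modeq n L (dil p x) (dil p y) = 0.
  rewrite -dil_modeq //.
  by rewrite Py; apply/fpsP => i; rewrite coef_dil; case: ifP.
have [f3 i3 V3] := root_ext _ _ _ _ f2 (i2 _ _ V1) Pdy.
(* If nonzero, [base_eq] at Y has order at most (m n n) m by the counting bound. But Y agrees with
   x(t^l), where [base_eq] vanishes, up to order M - 1, which is larger. *)
apply/eqP; apply: contraT => /ord_exists[o o_ord o_nz].
have := filtration_ord f3 x0 x1 (i3 _ _ (i2 _ _ Vx)) _ o_ord o_nz.
have lo : (M.-1 <= o)%N.
  apply: ordge_coef_neq0 o_nz; rewrite -[base_eq _ _ _ _]subr0 -By'.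
  have dyy' : eqm M.-1 (dil p y) (dil p y').
    by rewrite /eqm -dilB; apply: ordgeW (ordge_dil (m := p) lyy'); rewrite leq_pmull.
  by apply: eqmD; [apply: eqmD; do 2! apply: eqmX | apply: eqmM; apply: eqmX].
move/(_ m) => le; have : (M.-1 <= m * n * n * m)%N.
  apply: leq_trans lo _; rewrite mul1n in le; apply: le; apply: (filtD f3).
    by apply: (filtD f3); rewrite -exprM -[X in _ X (_ ^+ _)]mul1n;
      apply: (filtX _ f3); [apply: i3 | ].
  apply: (filtW f3 le2c); apply: (filtM f3).
    by rewrite -[X in _ X (_ ^+ _)]mul1n; apply: (filtX _ f3); apply: i3.
  by rewrite -[X in _ X (_ ^+ _)]mul1n; apply: (filtX _ f3).
have -> : (m * n * n * m = m ^ 2 * n ^ 2)%N by rewrite -!mulnn; lia.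
by move: lt_M; rewrite -/m -/n; set e := (_ * _)%N; lia.
Qed.

End ModularEquation.

(** * The Euler product *)

Section EulerProduct.
Local Open Scope ring_scope.
Variable k : fieldType.
Hypothesis char2 : 2%N \in [pchar k].
Local Notation t := (tX k).

(** In characteristic 2 the factor 1 - t^i is 1 + t^i. *)
Definition eprod (m n : nat) : fps k := \prod_(m <= i < n) (1 + t ^+ i.+1).

Lemma eprod_nn n : eprod n n = 1. Proof. by rewrite /eprod big_geq. Qed.

Lemma ordge_tXn m (a : fps k) : ordge m (t ^+ m * a).
Proof. by move=> i lt_im; rewrite coef_tXnM lt_im. Qed.

Lemma eprod_eqm m n N : (m <= n <= N)%N -> eqm n.+1 (eprod m N) (eprod m n).
Proof.
case/andP=> le_mn /subnKC <-; elim: (N - n)%N => [|d IHd]; first by rewrite addn0; exact: eqm_refl.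
rewrite addnS /eprod big_nat_recr ?leq_addr //=; last by rewrite (leq_trans le_mn) ?leq_addr.
rewrite mulrDr mulr1 /eqm addrAC; apply: ordgeD => //.
apply: ordgeMr; rewrite -[t ^+ _]mulr1; apply: ordgeW (@ordge_tXn _ _).
by rewrite ltnS leq_addr.
Qed.

Definition euler : fps k := Fps (fun n => (eprod 0 n)@_n).

Lemma euler_eqm n : eqm n.+1 euler (eprod 0 n).
Proof.
apply/eqmP => i; rewrite ltnS => le_in; have := @eprod_eqm 0 i n; rewrite le_in => /(_ isT).
by move/eqmP => ->.
Qed.

Lemma euler0 : euler@_0 = 1.
Proof. by rewrite /= eprod_nn. Qed.

(* Shanks' telescoping proof of the pentagonal number theorem. *)
Definition shanks n : fps k := \sum_(0 <= s < n.+1) eprod s n * t ^+ (s * n + 'C(s.+1, 2)).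

(** Splitting off the last factor of each product turns the summand s of [shanks n.+1] into that of
    [shanks n] plus B s + C s. Since B (s + 1) = C s and B 0 = 0, everything cancels except C n. *)
Lemma shanksS n : shanks n.+1 =
  shanks n + t ^+ (n.+1 * n + 'C(n.+2, 2)) + t ^+ (n.+1 * n.+1 + 'C(n.+2, 2)).
Proof.
rewrite /shanks big_nat_recr //= eprod_nn mul1r; congr (_ + _).
pose C s := eprod s n * t ^+ (s.+1 * n + 'C(s.+2, 2)).
pose B s := if s is s'.+1 then C s' else 0.
have -> : \sum_(0 <= s < n.+1) eprod s n.+1 * t ^+ (s * n.+1 + 'C(s.+1, 2)) =
   shanks n + \sum_(0 <= s < n.+1) (B s + C s).
  rewrite -big_split /= !big_nat; apply: eq_bigr => s /andP[_ lt_s].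
  have -> : eprod s n.+1 = eprod s n * (1 + t ^+ n.+1).
    by rewrite /eprod big_nat_recr.
  have -> : B s = eprod s n * (1 + t ^+ s) * t ^+ (s * n + 'C(s.+1, 2)).
    case: s lt_s => [_|s lt_s] /=; first by rewrite expr0 addaa // mulr0 mul0r.
    rewrite /C [eprod s n]/eprod big_ltn; last by [].
    by rewrite [_ * (1 + _)]mulrC.
  have -> : C s = eprod s n * (t ^+ (s * n + 'C(s.+1, 2)) * t ^+ n.+1 * t ^+ s).
    by rewrite /C -!exprD; congr (_ * _ ^+ _); rewrite [in LHS]binS bin1; lia.
  rewrite mulnS -[(s + s * n + _)%N]addnA exprD; move: (t ^+ _) (t ^+ s) (t ^+ n.+1) (eprod _ _) => u v w z.
  rewrite -[LHS](addKa char2 _ (z * u)); ring.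
congr (_ + _); rewrite big_split /= big_nat_recl // add0r.
rewrite [X in _ + X]big_nat_recr //= addrA addaa // add0r.
by rewrite /C eprod_nn mul1r.
Qed.

(** The summand s = 0 is the partial Euler product; the others have order greater than n. *)
Lemma shanks_euler n : eqm n.+1 euler (shanks n).
Proof.
apply: eqm_trans (@euler_eqm n) _; rewrite /shanks big_nat_recl // mul0n add0n expr0 mulr1.
rewrite /eqm opprD addrA subrr sub0r; apply: ordgeN.
apply: ordge_sum => s _ _; rewrite mulrC; apply: ordgeW (@ordge_tXn _ _).
have : (0 < 'C(s.+2, 2))%N by rewrite bin_gt0.
by rewrite mulSn; lia.
Qed.

Lemma shanks_sum n : shanks n =
  1 + \sum_(j < n) (t ^+ (j.+1 * j + 'C(j.+2, 2)) + t ^+ (j.+1 * j.+1 + 'C(j.+2, 2))).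
Proof.
elim: n => [|n IHn]; last by rewrite shanksS IHn big_ord_recr /= !addrA.
by rewrite /shanks big_nat1 big_ord0 addr0 eprod_nn mul1r.
Qed.

(** With i = j + 1 the exponents are the pentagonal numbers i (3 i - 1) / 2 and i (3 i + 1) / 2. *)
Lemma pent_sqr j : (24 * (j.+1 * j + 'C(j.+2, 2)) + 1 = (6 * j + 5) ^ 2)%N /\
   (24 * (j.+1 * j.+1 + 'C(j.+2, 2)) + 1 = (6 * j.+1 + 1) ^ 2)%N.
Proof.
have e : ('C(j.+2, 2) * 2 = j.+2 * j.+1)%N by rewrite mulnC (mul_bin_left j.+2 1) bin1; lia.
by rewrite -!mulnn; split; nia.
Qed.

Definition eta24 : fps k := psi k + dil 9 (psi k).

Lemma theta_eqm P e n N : (forall i, i <= e i)%N -> (n <= N)%N ->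
  eqm n (theta k P e) (\sum_(i < N | P i) t ^+ e i).
Proof.
move=> le_e le_nN; apply/eqmP => i lt_in; rewrite fcoef_sum.
rewrite (coef_theta _ _ le_e (leq_trans lt_in le_nN)) [RHS]big_mkcond /=.
by apply: eq_bigr => j _; case: (P j) => //=; rewrite coef_tXn eq_sym.
Qed.

Lemma big_odd N (F : nat -> fps k) :
  \sum_(i < (2 * N)%N | odd i) F i = \sum_(j < N) F (2 * j + 1)%N.
Proof.
elim: N => [|N IHN]; first by rewrite !big_ord0.
rewrite [(2 * N.+1)%N]mulnS addnC addn2 big_mkcond !big_ord_recr /= -big_mkcond IHN.
by rewrite oddM /= addr0 addn1.
Qed.

Lemma big_odd3 N (F : nat -> fps k) : \sum_(j < (3 * N)%N) F j =
  \sum_(j < N) (F (3 * j)%N + F (3 * j + 1)%N + F (3 * j + 2)%N).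
Proof.
elim: N => [|N IHN]; first by rewrite !big_ord0.
rewrite [(3 * N.+1)%N]mulnS addnC addn3 !big_ord_recr /= IHN addn1 addn2.
by rewrite -!addrA.
Qed.

(** Modulo 2, adding psi(t^9) removes from psi(t) the squares of odd multiples of 3. The squares of
    6 j + 1 and 6 j + 5 remain, as in the pentagonal number theorem. *)
Lemma eta24_euler : eta24 = t * dil 24 euler.
Proof.
apply: eqm_eq => n.
have E1 : eqm n eta24 (\sum_(j < n) (t ^+ ((6 * j + 1) ^ 2) + t ^+ ((6 * j + 5) ^ 2))).
  have Ea := @theta_eqm odd _ n (2 * (3 * n))%N leq_self_sqr.
  have Eb := @theta_eqm odd (fun i => 9 * i ^ 2)%N n (2 * n)%N.
  apply: (@eqm_trans _ _ _ (\sum_(i < (2 * (3 * n))%N | odd i) t ^+ (i ^ 2)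
      + \sum_(i < (2 * n)%N | odd i) t ^+ (9 * i ^ 2))).
    rewrite /eta24 /psi dil_theta //; last exact: leq_self_sqr.
    by apply: eqmD; [apply: Ea; lia | apply: Eb => [i|]; [apply: leq_mul_sqr | lia]].
  rewrite (big_odd (3 * n) (fun i => t ^+ (i ^ 2))) (big_odd n (fun i => t ^+ (9 * i ^ 2))) (big_odd3 n (fun j => t ^+ ((2 * j + 1) ^ 2))) -big_split /=.
  rewrite (eq_bigr (fun j : 'I_n => t ^+ ((6 * j + 1) ^ 2) + t ^+ ((6 * j + 5) ^ 2))).
    exact: eqm_refl.
  move=> j _; set u := t ^+ _; set v := t ^+ _; set w := t ^+ _; set z := t ^+ _.
  (* Of three consecutive odd numbers 6 j + 1, 6 j + 3, 6 j + 5, the middle one is 3 (2 j + 1), and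
     its square is the exponent from psi(t^9). *)
  have -> : z = v by rewrite /z /v -!mulnn; congr (_ ^+ _); lia.
  have -> : u + v + w + v = u + w by rewrite addrAC addKa.
  by rewrite /u /w; congr (_ ^+ (_ ^ 2) + _ ^+ (_ ^ 2)); lia.
apply: eqm_trans E1 _; case: n => [|n]; first by move=> i.
have E2 : eqm n.+1 (t * dil 24 euler) (t * dil 24 (shanks n.+1)).
  apply: eqmM; first exact: eqm_refl.
  rewrite /eqm -dilB; apply: ordgeW (ordge_dil (m := 24) (@shanks_euler n.+1)); lia.
apply: eqm_sym; apply: eqm_trans E2 _; rewrite shanks_sum rmorphD rmorph1 rmorph_sum /=.
rewrite mulrDr mulr1 mulr_sumr.
rewrite (eq_bigr (fun j : 'I_n.+1 => t ^+ ((6 * j + 5) ^ 2) + t ^+ ((6 * j.+1 + 1) ^ 2))).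
  (* The isolated term t is B 0, so the two sums differ by a shift of one index; the surplus B (n +
     1) lies beyond the precision. *)
  pose B j : fps k := t ^+ ((6 * j + 1) ^ 2).
  have eB : t + \sum_(j < n.+1) B j.+1 = \sum_(j < n.+1) B j + B n.+1.
    by transitivity (\sum_(j < n.+2) B j); [rewrite [RHS]big_ord_recl | rewrite big_ord_recr].
  rewrite !big_split /= addrCA addrC eB addrAC; set u := _ + _.
  rewrite /eqm addrAC subrr add0r /B -[t ^+ _]mulr1; apply: ordgeW (@ordge_tXn _ _).
  by rewrite -mulnn; nia.
move=> j _; have [e1 e2] := pent_sqr j.
rewrite rmorphD !rmorphXn /= dil_tX // -!exprM mulrDr -!exprS.
by rewrite -e1 -e2 !addn1.
Qed.

End EulerProduct.

(** * Computation with truncated series over F_2 *)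

(* Lists of bits, least significant first, as polynomials over F_2. *)
Fixpoint xorb (s1 s2 : bitseq) : bitseq :=
  match s1, s2 with
  | [::], _ => s2
  | _, [::] => s1
  | b1 :: s1', b2 :: s2' => (b1 (+) b2) :: xorb s1' s2'
  end.

Fixpoint mulb (s1 s2 : bitseq) : bitseq :=
  if s1 is b1 :: s1' then
    let s := false :: mulb s1' s2 in if b1 then xorb s2 s else s
  else [::].

Fixpoint dilb (m : nat) (s : bitseq) : bitseq :=
  if s is b1 :: s' then b1 :: nseq m.-1 false ++ dilb m s' else [::].

Definition monob (m : nat) : bitseq := nseq m false ++ [:: true].

Definition pentb (j : nat) (s : bitseq) : bitseq :=
  xorb (monob (j.+1 * j + (j.+2 * j.+1)./2))
    (xorb (monob (j.+1 * j.+1 + (j.+2 * j.+1)./2)) s).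

Definition eulerb (J K : nat) : bitseq := take K (foldr pentb (monob 0) (iota 0 J)).

(* Computes [u ^+ a * v ^+ b] modulo [t ^ K] for a, b < 2 ^ r; over F_2 squaring
   is [dilb 2]. *)
Fixpoint powb (K : nat) (u v : bitseq) (r a b : nat) : bitseq :=
  if r is r'.+1 then
    let s := take K (dilb 2 (powb K u v r' a./2 b./2)) in
    let s1 := if odd a then take K (mulb u s) else s in
    if odd b then take K (mulb v s1) else s1
  else [:: true].

(** The equation at eta(t) = t E(t^24) and eta(t^l), divided by t^(l+1) and written in q = t^24. The
    monomial with exponents a, b acquires the factor q^((a + l b - l - 1) / 24). Five rounds of
    [powb] handle exponents below 32. *)
Definition modeqb (J K l : nat) (L : seq (nat * nat)) : bitseq :=
  let u := eulerb J K in
  let v := take K (dilb l u) in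
  foldr (fun ab s => xorb (nseq ((ab.1 + l * ab.2 - l.+1) %/ 24) false
                             ++ powb K u v 5 ab.1 ab.2) s)
    [::] [:: (l.+1, 0), (0, l.+1), (1, 1) & L].

Section BitSeries.
Local Open Scope ring_scope.
Variable k : fieldType.
Hypothesis char2 : 2%N \in [pchar k].
Local Notation t := (tX k).
Implicit Types (s u v : bitseq).

Definition bser s : fps k := Fps (fun n => (nth false s n)%:R).

Lemma bser_nil : bser [::] = 0.
Proof. by apply/fpsP => n /=; rewrite nth_nil. Qed.

Lemma bser_cons b1 s : bser (b1 :: s) = b1%:R + t * bser s.
Proof.
apply/fpsP => -[|n]; rewrite fcoefD coef_tXM fcoef_natr ?addr0 ?mulr1n //=.
by rewrite mulr0n add0r.
Qed.

Lemma bser_nseq m s : bser (nseq m false ++ s) = t ^+ m * bser s.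
Proof.
elim: m => [|m IHm]; first by rewrite mul1r.
by rewrite /= bser_cons add0r IHm exprS mulrA.
Qed.

Lemma bser_monob m : bser (monob m) = t ^+ m.
Proof. by rewrite bser_nseq bser_cons bser_nil mulr0 addr0 mulr1. Qed.

Lemma bser_xorb u v : bser (xorb u v) = bser u + bser v.
Proof.
elim: u v => [|b1 u IHu] [|b2 v]; rewrite ?bser_nil ?add0r ?addr0 //=.
rewrite !bser_cons IHu mulrDr addrACA; congr (_ + _).
by case: b1; case: b2; rewrite ?addr0 ?add0r //= addaa.
Qed.

Lemma bser_mulb u v : bser (mulb u v) = bser u * bser v.
Proof.
elim: u => [|b1 u IHu]; first by rewrite bser_nil mul0r.
rewrite [mulb _ _]/= bser_cons mulrDl -mulrA -IHu; case: b1.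
  by rewrite bser_xorb bser_cons add0r mul1r.
by rewrite bser_cons mul0r.
Qed.

Lemma bser_dilb m s : (0 < m)%N -> bser (dilb m s) = dil m (bser s).
Proof.
case: m => // m _; elim: s => [|b1 s IHs] /=; first by rewrite bser_nil rmorph0.
by rewrite !bser_cons bser_nseq IHs rmorphD rmorphM rmorph_nat /= dil_tX // mulrA -exprS.
Qed.

Lemma bser_take K s : eqm K (bser (take K s)) (bser s).
Proof. by apply/eqmP => i lt_iK /=; rewrite nth_take. Qed.

Lemma isF2_bser s : isF2 (bser s).
Proof. by move=> n; rewrite isF2_natr. Qed.

(** The omitted pentagonal exponents are at least J^2, hence at least K. *)
Lemma bser_eulerb J K : (K <= J ^ 2)%N -> eqm K (bser (eulerb J K)) (euler k).
Proof.
move=> le_K; apply: eqm_trans (@bser_take _ _) _.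
set s := foldr _ _ _; have -> : bser s = shanks k J.
  rewrite shanks_sum // /s -(big_mkord xpredT (fun j =>
    (t ^+ (j.+1 * j + 'C(j.+2, 2)) + t ^+ (j.+1 * j.+1 + 'C(j.+2, 2))))) /index_iota subn0.
  elim: (iota 0 J) => [|j r IHr]; first by rewrite big_nil addr0 bser_monob.
  have -> : foldr pentb (monob 0) (j :: r) = pentb j (foldr pentb (monob 0) r) by [].
  rewrite big_cons /pentb !bser_xorb IHr !bser_monob !bin2 !succnK.
  by rewrite addrA addrCA.
have shanks_eqm d : eqm K (shanks k (J + d)) (shanks k J).
  elim: d => [|d IHd]; first by rewrite addn0; apply: eqm_refl.
  rewrite addnS shanksS // -addrA /eqm addrAC; apply: ordgeD => //.
  have big m : (K <= m)%N -> ordge K (t ^+ m).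
    by move=> le_m; rewrite -[t ^+ _]mulr1; apply: ordgeW (@ordge_tXn _ _ _).
  by apply: ordgeD; apply: big; apply: leq_trans le_K _; nia.
apply: eqm_sym; apply: eqm_trans (shanks_eqm K).
by apply: eqmW (@shanks_euler _ char2 (J + K)%N); lia.
Qed.

Lemma bser_powb K u v r a b : (a < 2 ^ r)%N -> (b < 2 ^ r)%N ->
  eqm K (bser (powb K u v r a b)) (bser u ^+ a * bser v ^+ b).
Proof.
elim: r a b => [|r IHr] a b.
  rewrite !ltnS !leqn0 => /eqP -> /eqP ->; rewrite !expr0 mulr1 /= bser_cons bser_nil.
  by rewrite mulr0 addr0; apply: eqm_refl.
rewrite expnS => lt_a lt_b.
have E c (m : nat) : c ^+ m = c ^+ odd m * (c ^+ m./2) ^+ 2 :> fps k.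
  by rewrite -exprM -exprD muln2 odd_double_half.
have step (x : bool) w s c : eqm K (bser s) c ->
    eqm K (bser (if x then take K (mulb w s) else s)) (bser w ^+ x * c).
  case: x => sc; last by rewrite mul1r.
  by apply: eqm_trans (@bser_take _ _) _; rewrite bser_mulb expr1; apply: eqmM.
rewrite /= (E _ a) (E _ b) mulrACA mulrC.
have -> : bser u ^+ odd a * bser v ^+ odd b = bser v ^+ odd b * bser u ^+ odd a.
  by rewrite mulrC.
rewrite mulrC -mulrA; apply/step/step; apply: eqm_trans (@bser_take _ _) _.
rewrite bser_dilb // -frobenius_F2 //; last exact: isF2_bser.
by rewrite -exprMn; apply/eqmX/IHr; lia.
Qed.

(** K zero bits in q = t^24 give order 24 K in t, to which the factor t^(l+1) is added. This is the
    order required by [modular_equation]. *)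
Lemma bser_modeqb J K l L : (0 < l < 31)%N -> (24 %| l.+1 * l.-1)%N -> (K <= J ^ 2)%N ->
    all (fun ab => [&& ab.1 <= l.+1, ab.2 <= l.+1, l.+1 < ab.1 + l * ab.2
                     & 24 %| ab.1 + l * ab.2 - l.+1])%N L ->
    all negb (take K (modeqb J K l L)) ->
  ordge (l.+1 + 24 * K) (modeq l.+1 L (eta24 k) (dil l (eta24 k))).
Proof.
move=> /andP[l_gt0 lt_l] dv_l le_K Lall Kall; set n := l.+1.
pose E := euler k; pose L' := [:: (n, 0), (0, n), (1, 1) & L]%N.
have L'all : all (fun ab => [&& ab.1 <= n, ab.2 <= n, n <= ab.1 + l * ab.2
    & 24 %| ab.1 + l * ab.2 - n])%N L'.
  rewrite /L' /=; apply/and4P; split.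
  - by rewrite leqnn muln0 addn0 leqnn subnn.
  - rewrite leqnn add0n leq_pmull //=.
    by rewrite [(l * n)%N]mulnC -[X in (_ - X)%N]muln1 -mulnBr subn1.
  - by rewrite muln1 add1n leqnn subnn /n; lia.
  - by apply: sub_all Lall => ab /and4P[-> -> /ltnW -> ->].
have -> : modeq n L (eta24 k) (dil l (eta24 k)) =
    t ^+ n * dil 24 (\sum_(ab <- L') t ^+ ((ab.1 + l * ab.2 - n) %/ 24)
                                       * (E ^+ ab.1 * (dil l E) ^+ ab.2)).
  have -> : modeq n L (eta24 k) (dil l (eta24 k)) =
      \sum_(ab <- L') (eta24 k) ^+ ab.1 * dil l (eta24 k) ^+ ab.2.
    by rewrite !big_cons /modeq !expr0 mulr1 mul1r !expr1 !addrA.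
  rewrite rmorph_sum mulr_sumr !big_seq; apply: eq_bigr => ab /(allP L'all)/and4P[_ _ le_n dv].
  rewrite !rmorphM !rmorphXn /= dil_tX // -exprM mulnC divnK //.
  have -> : dil 24 (dil l E) = dil l (dil 24 E) by rewrite !dil_dil // mulnC.
  rewrite eta24_euler // dilM // dil_tX // !exprMn -exprM [LHS]mulrACA -exprD [RHS]mulrA -exprD.
  by rewrite subnKC.
apply: ordgeM; first by move=> i lt_i; rewrite coef_tXn ltn_eqF.
apply: ordge_dil; rewrite -[\sum_(_ <- _) _]subr0.
have bK : eqm K (bser (modeqb J K l L)) 0.
  apply: eqm_trans (eqm_sym (@bser_take _ _)) _; apply/eqmP => i lt_i.
  move/all_nthP: Kall => /(_ false i) /=; case: ltnP => [_ /(_ isT) /negPf ->|le_i _] //.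
  by rewrite nth_default.
apply: eqm_trans (eqm_sym _) bK.
have bE := bser_eulerb le_K.
rewrite /modeqb; have : (n < 2 ^ 5)%N := lt_l.
move: (5)%N => r lt_nr; move: L'all; rewrite -/n -/L'; elim: L' => [|ab L1 IHL] /=.
  by rewrite bser_nil big_nil => _; apply: eqm_refl.
case/andP=> /and4P[le_a le_b _ _] /IHL{}IHL.
rewrite bser_xorb bser_nseq big_cons; apply: eqmD => //; apply: eqmM; first exact: eqm_refl.
apply: eqm_trans (@bser_powb _ _ _ _ _ _ _ _) _; try exact: leq_ltn_trans lt_nr.
apply: eqmM; apply: eqmX => //; apply: eqm_trans (@bser_take _ _) _.
by rewrite bser_dilb // /eqm -dilB; apply: ordgeW (ordge_dil (m := l) bE); rewrite leq_pmull.
Qed.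

End BitSeries.

(** * The modular equations of levels 5, 7 and 29 *)

Section ModularEquations.
Local Open Scope ring_scope.
Variable k : fieldType.
Hypothesis char2 : 2%N \in [pchar k].
Local Notation t := (tX k).
Local Notation eta := (eta24 k).
Local Notation E := (euler k).
Local Notation phi := (euler k)^-1.

Lemma psi_sqr a : odd a -> (psi k)@_(a ^ 2) = 1.
Proof.
move=> odd_a; rewrite (coef_theta _ _ leq_self_sqr (_ : a ^ 2 < (a ^ 2).+1)%N) //.
have lt_a : (a < (a ^ 2).+1)%N by rewrite ltnS leq_self_sqr.
rewrite (bigD1 (Ordinal lt_a)) //= odd_a eqxx big1 ?addr0 // => j.
by rewrite -val_eqE /= eqn_sqr => /negPf->; rewrite andbF.
Qed.

Lemma psi_neq0 n : (psi k)@_n != 0 -> exists2 a, odd a & n = (a ^ 2)%N.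
Proof.
rewrite /psi /= => /eqP nz; apply: contrapT => no_a; apply: nz; rewrite big1 // => a _.
by case: andP => // -[odd_a /eqP e]; case: no_a; exists a.
Qed.

Lemma psi01 n : (psi k)@_n = 0 \/ (psi k)@_n = 1.
Proof.
have [|/psi_neq0[a odd_a ->]] := eqVneq ((psi k)@_n) 0; first by left.
by right; apply: psi_sqr.
Qed.

Lemma eta_0 : eta@_0 = 0.
Proof. by rewrite eta24_euler // fcoefM0 mul0r. Qed.

Lemma eta_1 : eta@_1 = 1.
Proof. by rewrite eta24_euler // coef_tXM coef_dil dvdn0 div0n euler0. Qed.

Lemma eta_neq0 : eta != 0.
Proof. by apply/eqP => e; have /eqP := eta_1; rewrite e eq_sym oner_eq0. Qed.

(** Write u, v, w for psi at t, t^3, t^9. Then eta^4 = u^4 + w^4 = (u v + v^4) + (v^4 + v w) = v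
    eta, and eta can be cancelled. *)
Lemma eta_cube : eta ^+ 3 = dil 3 (psi k).
Proof.
have e1 := psi_base char2.
have e2 : (dil 3 (psi k)) ^+ 4 + (dil 9 (psi k)) ^+ 4 = dil 3 (psi k) * dil 9 (psi k).
  by have := congr1 (dil 3) e1; rewrite dilD dilM // !dilX // dil_dil.
apply: (mulfI eta_neq0); rewrite -exprS /eta24 exp4D_char2 // mulrDl -e1.
by rewrite [dil 9 _ * _]mulrC -e2 addrA addKa.
Qed.

Lemma eta_base3 : base_eq 3 3 eta (dil 3 eta) = 0.
Proof.
have := congr1 (dil 3) (psi_base char2); rewrite dilD dilM // !dilX // => e.
by rewrite /base_eq -dilX // eta_cube e addaa.
Qed.

(** With c = p = 3 and l = 5 the bound is 12^2 6^2 + 1 = 5185, and 6 + 24 * 216 = 5190 exceeds it;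
    15 pairs suffice as 15^2 >= 216. *)
Lemma check5 : all negb (take 216 (modeqb 15 216 5 [::])).
Proof. by vm_compute. Qed.

Lemma eta_modeq5 : modeq 6 [::] eta (dil 5 eta) = 0.
Proof.
apply: (modular_equation char2 (c := 3) (p := 3) (M := (6 + 24 * 216)%N)) => //.
- exact: eta_0.
- exact: eta_1.
- exact: eta_base3.
exact: (@bser_modeqb k char2 15 216 5 [::] isT isT isT isT check5).
Qed.

Lemma eta_base5 : base_eq 1 5 eta (dil 5 eta) = 0.
Proof. by rewrite -eta_modeq5 /base_eq /modeq big_nil addr0 !expr1. Qed.

Definition modeq7_terms : seq (nat * nat) := [:: (4, 4)]%N.

(** From here the level 5 equation is the known one, with c = 1 and p = 5. The bound is 6^2 8^2 + 1
    = 2305 < 8 + 24 * 96. *)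
Lemma check7 : all negb (take 96 (modeqb 10 96 7 modeq7_terms)).
Proof. by vm_compute. Qed.

Lemma eta_modeq7 : modeq 8 modeq7_terms eta (dil 7 eta) = 0.
Proof.
apply: (modular_equation char2 (c := 1) (p := 5) (M := (8 + 24 * 96)%N)) => //.
- exact: eta_0.
- exact: eta_1.
- exact: eta_base5.
exact: (@bser_modeqb k char2 10 96 7 modeq7_terms isT isT isT isT check7).
Qed.

(** The list is symmetric in the two exponents. Its only term linear in the second variable is (25,
    1), the source of t phi^5 in the trace. *)
Definition modeq29_terms : seq (nat * nat) := [:: (1, 25); (2, 20); (3, 15); (4, 10); (5, 5); (6, 24);
  (8, 14); (10, 4); (14, 8); (15, 3); (20, 2); (24, 6); (25, 1)]%N.

(** The bound is 6^2 30^2 + 1 = 32401 < 30 + 24 * 1349, and 37^2 >= 1349. *)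
Lemma check29 : all negb (take 1349 (modeqb 37 1349 29 modeq29_terms)).
Proof. by vm_compute. Qed.

Lemma eta_modeq29 : modeq 30 modeq29_terms eta (dil 29 eta) = 0.
Proof.
apply: (modular_equation char2 (c := 1) (p := 5) (M := (30 + 24 * 1349)%N)) => //.
- exact: eta_0.
- exact: eta_1.
- exact: eta_base5.
exact: (@bser_modeqb k char2 37 1349 29 modeq29_terms isT isT isT isT check29).
Qed.

(** The formula for the sum of the inverses of the roots from the two lowest coefficients. The
    cofactor [u.2] stands for m / [u.1], so that no division occurs. *)
Lemma prod_XsubC_coef01 (R : comNzRingType) (m : R) (s : seq (R * R)) :
    (forall u, u \in s -> u.1 * u.2 = m) ->
  let p := \prod_(u <- s) ('X - u.1%:P) in m * p`_1 = - p`_0 * \sum_(u <- s) u.2.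
Proof.
move=> sm /=; elim: s sm => [|u s IHs] sm.
  by rewrite !big_nil coefC /= !mulr0.
rewrite !big_cons; set p := \prod_(_ <- _) _ in IHs *.
have {}IHs := IHs (fun v sv => sm v (mem_behead (s := u :: s) sv)).
have mE := sm u (mem_head u s).
rewrite mulrBl !coefB coefXM coefXM /= !coefCM sub0r opprK mulrBr mulrCA IHs -mE.
by ring.
Qed.

End ModularEquations.

(** * Traces of conjugates *)

Lemma monic_prod_XsubC (R : idomainType) (q : {poly R}) (rs : seq R) :
    (q \is monic -> size q = (size rs).+1 -> all (root q) rs -> uniq rs ->
  q = \prod_(r <- rs) ('X - r%:P))%R.
Proof.
elim: rs q => [|r rs IHrs] q mon_q szq.
  move/eqP: szq => /size_poly1P[c _ qc] _ _; move: mon_q; rewrite big_nil qc.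
  by rewrite monicE lead_coefC => /eqP ->.
case/andP=> /factor_theorem[q1 qE] /allP rs_root /andP[r_rs uniq_rs].
have mon_q1 : (q1 \is monic)%R by move: mon_q; rewrite qE monicMr ?monicXsubC.
rewrite big_cons mulrC qE -(IHrs q1) //.
  by move: szq; rewrite qE size_Mmonic ?monic_neq0 ?monicXsubC // size_XsubC addn2 => -[].
apply/allP => x rs_x; have := rs_root x rs_x; rewrite qE rootM root_XsubC.
by case/orP => // /eqP xr; rewrite -xr rs_x in r_rs.
Qed.

Section Traces.
Lemma coef_res (R : fieldType) l (a : fps R) n : (res l a)@_n = if l %| n then a@_n else 0%R.
Proof. by []. Qed.
Local Open Scope ring_scope.
Variable k : fieldType.
Hypothesis char2 : 2%N \in [pchar k].
Local Notation t := (tX k).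
Local Notation eta := (eta24 k).
Local Notation E := (euler k).
Local Notation phi := (euler k)^-1.

Definition modpoly n L (y : fps k) : {poly fps k} :=
  'X^n + (y ^+ n)%:P + y%:P * 'X + \sum_(ab <- L) (y ^+ ab.1)%:P * 'X^(ab.2).

Lemma horner_modpoly n L y r : (modpoly n L y).[r] = modeq n L y r.
Proof.
rewrite /modpoly /modeq !hornerE horner_sum.
congr (_ + _ + _); first by rewrite addrC.
by apply: eq_bigr => ab _; rewrite !hornerE.
Qed.

Lemma coef_modpoly n L y i : (modpoly n L y)`_i =
  (i == n)%:R + y ^+ n *+ (i == 0)%N + y *+ (i == 1)%N + \sum_(ab <- L | ab.2 == i) y ^+ ab.1.
Proof.
rewrite /modpoly !coefD coefXn coefC coefCM coefX coef_sum.
congr (_ + _ + _ + _); first by case: eqP.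
  by rewrite mulr_natr.
rewrite [RHS]big_mkcond; apply: eq_bigr => ab _.
by rewrite coefCM coefXn eq_sym; case: eqP; rewrite ?mulr1 ?mulr0.
Qed.

Lemma euler_unit : E \is a GRing.unit.
Proof. by rewrite fps_unitE euler0 oner_neq0. Qed.

Section Trace.
Variables (l : nat) (L : seq (nat * nat)) (z : k).
Hypotheses (l_gt1 : (1 < l)%N) (odd_l : odd l) (prim_z : l.-primitive_root z).
Hypothesis Llt : all (fun ab => 0 < ab.2 < l.+1)%N L.
Hypothesis Lsym : perm_eq [seq (ab.2, ab.1) | ab <- L] L.
Hypothesis mod_eta : modeq l.+1 L eta (dil l eta) = 0.
Local Notation y := (dil l eta).
Local Notation m := (t ^+ (l ^ 2)).

(** The cofactor t^(l^2) / eta, a power series although 1 / eta has a pole. *)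
Definition etainv : fps k := t ^+ (l ^ 2).-1 * dil 24 phi.

(* The l.+1 conjugates of eta over the series in t ^ l, each paired with the
   cofactor that gives the product t ^ (l ^ 2). *)
Definition conjugates : seq (fps k * fps k) :=
  (dil l y, dil (24 * l ^ 2) phi)
    :: [seq (tw (z ^+ i) eta, tw (z ^+ i) etainv) | i <- iota 0 l].

Lemma sum_conjugates (g : fps k -> fps k) :
  \sum_(u <- conjugates) g u.2 = g (dil (24 * l ^ 2) phi) + \sum_(i < l) g (tw (z ^+ i) etainv).
Proof.
by rewrite big_cons big_map -(big_mkord xpredT (fun i => g (tw (z ^+ i) etainv))) /index_iota subn0.
Qed.

Lemma sum_conjugates1 (g : fps k -> fps k) :
  \sum_(u <- conjugates) g u.1 = g (dil l y) + \sum_(i < l) g (tw (z ^+ i) eta).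
Proof.
by rewrite big_cons big_map -(big_mkord xpredT (fun i => g (tw (z ^+ i) eta))) /index_iota subn0.
Qed.

Let l_gt0 : (0 < l)%N. Proof. exact: ltnW. Qed.

Lemma zl i : z ^+ i ^+ l = 1.
Proof. by rewrite exprAC (prim_expr_order prim_z) expr1n. Qed.

Lemma tw_dil i a : tw (z ^+ i) (dil l a) = dil l a.
Proof.
apply/fpsP => n; rewrite coef_tw coef_dil; case: ifP => [/dvdnP[j ->]|]; last by rewrite mulr0.
by rewrite mulnC exprM zl expr1n mul1r.
Qed.

Lemma dil_eta n : (0 < n)%N -> dil n eta = t ^+ n * dil (24 * n) E.
Proof. by move=> n_gt0; rewrite eta24_euler // dilM // dil_tX // dil_dil // mulnC. Qed.

Lemma dil_phi n : (0 < n)%N -> dil n E * dil n phi = 1.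
Proof. by move=> n_gt0; rewrite -dilM // mulrV ?dil1 // euler_unit. Qed.

Lemma conjugate_mul u : u \in conjugates -> u.1 * u.2 = m.
Proof.
have l2 : (0 < l ^ 2)%N by rewrite expn_gt0 l_gt0.
rewrite inE => /predU1P[->|/mapP[i _ ->]] /=.
  rewrite dil_dil // mulnn dil_eta ?expn_gt0 ?l_gt0 //.
  by rewrite -mulrA dil_phi ?mulr1 // muln_gt0.
rewrite -rmorphM eta24_euler // /etainv mulrACA -exprS prednK // dil_phi // mulr1.
by rewrite /= -mulnn exprM -dil_tX // -dilX // tw_dil.
Qed.

(** By symmetry eta is a root at y = eta(t^l). Twisting fixes y, a series in t^l, and moves eta to
    its other conjugates; dilating the original equation gives the remaining root eta(t^(l^2)). *)
Lemma conjugate_root u : u \in conjugates -> modeq l.+1 L y u.1 = 0.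
Proof.
have modC a b : modeq l.+1 L a b = modeq l.+1 L b a.
  rewrite /modeq [b ^+ _ + _]addrC [b * a]mulrC; congr (_ + _).
  rewrite -(perm_big _ Lsym) big_map; apply: eq_bigr => ab _ /=.
  by rewrite mulrC.
rewrite inE => /predU1P[->|/mapP[i _ ->]] /=; first by rewrite -dil_modeq // mod_eta dil0.
by rewrite -{1}(tw_dil i eta) -rmorph_modeq modC mod_eta rmorph0.
Qed.

Lemma uniq_conjugates : uniq (map fst conjugates).
Proof.
rewrite /= -map_comp; apply/andP; split.
  apply/mapP => -[i _ e]; have : (dil l y)@_1 = (tw (z ^+ i) eta)@_1 by rewrite e.
  rewrite coef_tw eta_1 // expr1 mulr1 coef_dil dvdn1 gtn_eqF // => /esym/eqP.
  move=> z0; have /eqP := zl i; rewrite (eqP z0) expr0n gtn_eqF //.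
  by rewrite eq_sym oner_eq0.
rewrite map_inj_in_uniq ?iota_uniq // => i j; rewrite !mem_iota /= => lt_i lt_j.
move=> e; have : (tw (z ^+ i) eta)@_1 = (tw (z ^+ j) eta)@_1 by congr (_ @_ 1).
rewrite !coef_tw eta_1 // !expr1 !mulr1 => /eqP.
by rewrite (eq_prim_root_expr prim_z) !modn_small // => /eqP.
Qed.

(** The conjugates are l + 1 distinct roots of a monic polynomial of degree l + 1. *)
Lemma modpolyE : modpoly l.+1 L y = \prod_(u <- conjugates) ('X - u.1%:P).
Proof.
have szq : (size (y%:P * 'X + \sum_(ab <- L) (y ^+ ab.1)%:P * 'X^(ab.2))%R <= l.+1)%N.
  rewrite (leq_trans (size_polyD _ _)) // geq_max; apply/andP; split.
    by rewrite mul_polyC (leq_trans (size_scale_leq _ _)) // size_polyX ltnS.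
  rewrite (leq_trans (size_sum _ _ _)) //; apply/bigmax_leqP_seq => ab Lab _.
  rewrite mul_polyC (leq_trans (size_scale_leq _ _)) // size_polyXn.
  by case/andP: (allP Llt _ Lab).
have lq : (size ((y ^+ l.+1)%:P + (y%:P * 'X + \sum_(ab <- L) (y ^+ ab.1)%:P * 'X^(ab.2)))%R
    < size ('X^(l.+1) : {poly fps k})%R)%N.
  rewrite size_polyXn ltnS (leq_trans (size_polyD _ _)) // geq_max szq andbT.
  by rewrite (leq_trans (size_polyC_leq1 _)).
have pE : modpoly l.+1 L y = 'X^(l.+1) + ((y ^+ l.+1)%:P
    + (y%:P * 'X + \sum_(ab <- L) (y ^+ ab.1)%:P * 'X^(ab.2))).
  by rewrite /modpoly !addrA.
rewrite -(big_map fst xpredT (fun r => 'X - r%:P)); apply: monic_prod_XsubC.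
- by rewrite monicE pE lead_coefDl // lead_coefXn.
- by rewrite pE size_polyDl // size_polyXn /= !size_map size_iota.
- apply/allP => r /mapP[u /conjugate_root e ->].
  by rewrite /root horner_modpoly e.
exact: uniq_conjugates.
Qed.

(** The sum of the cofactors of the conjugates, read off from the two lowest coefficients of the
    polynomial. The twists sum to l [res l etainv], and l is odd. *)
Lemma trace_inv : y ^+ l.+1 * (dil (24 * l ^ 2) phi + res l etainv) =
  m * (y + \sum_(ab <- L | ab.2 == 1%N) y ^+ ab.1).
Proof.
have := prod_XsubC_coef01 conjugate_mul; cbv zeta; rewrite -modpolyE.
have -> : (modpoly l.+1 L y)`_0 = y ^+ l.+1.
  rewrite coef_modpoly big_seq_cond big1 => [|ab /andP[Lab /eqP e]].
    by rewrite /= mulr0n mulr0n mulr1n add0r !addr0.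
  by have := allP Llt _ Lab; rewrite e.
have -> : (modpoly l.+1 L y)`_1 = y + \sum_(ab <- L | ab.2 == 1%N) y ^+ ab.1.
  by rewrite coef_modpoly /= eqSS eq_sym gtn_eqF // mulr0n mulr0n mulr1n !add0r.
by rewrite oppa // (sum_conjugates (fun a => a)) sum_tw // [l%:R]fps_natr_odd // odd_l mul1r => <-.
Qed.

Lemma sum_conj_inv : \sum_(u <- conjugates) u.2 = dil (24 * l ^ 2) phi + res l etainv.
Proof.
by rewrite (sum_conjugates (fun a => a)) sum_tw // [l%:R]fps_natr_odd // odd_l mul1r.
Qed.

Lemma sum_conj_invX e :
  \sum_(u <- conjugates) u.2 ^+ e = dil (24 * l ^ 2) phi ^+ e + res l (etainv ^+ e).
Proof.
rewrite (sum_conjugates (fun a => a ^+ e)); congr (_ + _).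
under eq_bigr do rewrite -rmorphXn.
by rewrite sum_tw // [l%:R]fps_natr_odd // odd_l mul1r.
Qed.

Lemma sum_conj_etaX e :
  \sum_(u <- conjugates) u.1 ^+ e = dil l y ^+ e + res l (eta ^+ e).
Proof.
rewrite (sum_conjugates1 (fun a => a ^+ e)); congr (_ + _).
under eq_bigr do rewrite -rmorphXn.
by rewrite sum_tw // [l%:R]fps_natr_odd // odd_l mul1r.
Qed.

Lemma sum_conj_eta : \sum_(u <- conjugates) u.1 = - (modpoly l.+1 L y)`_l.
Proof.
rewrite modpolyE -(big_map fst xpredT (fun r => 'X - r%:P)).
have sz : size (map fst conjugates) = l.+1 by rewrite /= !size_map size_iota.
have := @coefPn_prod_XsubC _ (map fst conjugates); rewrite sz succnK => -> //.
by rewrite opprK big_map.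
Qed.

(* Cofactors 24 l N - (l ^ 2 - 1) = 24 (l N - c). *)
Lemma coef_sum_inv c N : (l ^ 2 = 24 * c + 1)%N ->
  (dil (24 * l ^ 2) phi + res l etainv)@_(24 * l * N) =
  (dil l phi)@_N + (if (l * N < c)%N then 0 else phi@_(l * N - c)).
Proof.
move=> l2; rewrite fcoefD; congr (_ + _).
  by rewrite -mulnn mulnA -dil_dil ?muln_gt0 ?l_gt0 // coef_dil_mul ?muln_gt0 ?l_gt0.
rewrite coef_res -mulnA mulnCA dvdn_mulr // /etainv coef_tXnM l2 addn1 succnK.
rewrite mulnCA ltn_pmul2l //; case: ifP => // _.
by rewrite -mulnBr coef_dil_mul.
Qed.

End Trace.
Lemma dil_eta_neq0 n : (0 < n)%N -> dil n eta != 0.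
Proof. by move=> n_gt0; rewrite -(dil0 k n) (inj_eq (dil_inj n_gt0)) eta_neq0. Qed.

(** Here u = t^29, F = E(t^(24 * 29)), f = 1 / F, and u F = eta(t^29). Abstracting them leaves an
    identity that [ring] proves. *)
Lemma solve_trace29 (R : idomainType) (u f F S : R) : u * F != 0 -> F * f = 1 ->
    (u * F) ^+ 30 * S = u ^+ 29 * (u * F + (u * F) ^+ 25) ->
  S = f ^+ 29 + u ^+ 24 * f ^+ 5.
Proof.
move=> y_nz Ff eS; apply: (mulfI (expf_neq0 30 y_nz)); rewrite {}eS.
transitivity (u ^+ 30 * F * (F * f) ^+ 29 + u ^+ 54 * F ^+ 25 * (F * f) ^+ 5).
  by rewrite Ff !expr1n; ring.
by ring.
Qed.

Lemma trace_inv29 (z : k) : 29.-primitive_root z ->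
  dil (24 * 29 ^ 2) phi + res 29 (etainv 29) = dil (24 * 29) (phi ^+ 29 + t * phi ^+ 5).
Proof.
move=> prim_z; have := trace_inv (l := 29) (L := modeq29_terms) isT isT prim_z isT isT (eta_modeq29 char2).
rewrite [X in _ = _ * (_ + X)](_ : _ = dil 29 eta ^+ 25); last first.
  by rewrite -big_filter [filter _ _]/= big_seq1.
have y_nz : dil 29 eta != 0 by apply: dil_eta_neq0.
have -> : dil (24 * 29) (phi ^+ 29 + t * phi ^+ 5) =
    dil (24 * 29) phi ^+ 29 + (t ^+ 29) ^+ 24 * dil (24 * 29) phi ^+ 5.
  have h : (0 < 24 * 29)%N by [].
  by rewrite dilD (dilM _ _ h) !(dilX _ _ h) (dil_tX _ h) mulnC exprM.
move: y_nz; rewrite (@dil_eta 29 isT) => y_nz.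
have -> : t ^+ (29 ^ 2) = (t ^+ 29) ^+ 29 by rewrite -exprM mulnn.
exact: solve_trace29 y_nz (dil_phi (_ : 0 < 24 * 29)%N).
Qed.

Lemma solve_trace5 (R : idomainType) (u f F S : R) : u * F != 0 -> F * f = 1 ->
    (u * F) ^+ 6 * S = u ^+ 5 * (u * F) ->
  S = f ^+ 5.
Proof.
move=> y_nz Ff eS; apply: (mulfI (expf_neq0 6 y_nz)); rewrite {}eS.
transitivity (u ^+ 6 * F * (F * f) ^+ 5); last by ring.
by rewrite Ff expr1n; ring.
Qed.

Lemma trace_inv5 (z : k) : 5.-primitive_root z ->
  dil (24 * 5 ^ 2) phi + res 5 (etainv 5) = dil (24 * 5) (phi ^+ 5).
Proof.
move=> prim_z; have := trace_inv (l := 5) (L := [::]) isT isT prim_z isT isT (eta_modeq5 char2).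
rewrite big_nil addr0.
have y_nz : dil 5 eta != 0 by apply: dil_eta_neq0.
rewrite dilX //; move: y_nz; rewrite (@dil_eta 5 isT) => y_nz.
have -> : t ^+ (5 ^ 2) = (t ^+ 5) ^+ 5 by rewrite -exprM mulnn.
exact: solve_trace5 y_nz (dil_phi (_ : 0 < 24 * 5)%N).
Qed.

Lemma solve_trace5_5 (R : idomainType) (u f F S S5 : R) : u * F != 0 -> F * f = 1 ->
    S = f ^+ 5 -> (u * F) ^+ 6 * S5 = u * F * u ^+ 5 * S ^+ 4 ->
  S5 = f ^+ 25.
Proof.
move=> y_nz Ff -> eS; apply: (mulfI (expf_neq0 6 y_nz)); rewrite {}eS.
transitivity (u ^+ 6 * F * f ^+ 20 * (F * f) ^+ 5); last by ring.
by rewrite Ff expr1n; ring.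
Qed.

Lemma sum_exp4 (I : Type) (r : seq I) (F : I -> fps k) :
  \sum_(i <- r) F i ^+ 4 = (\sum_(i <- r) F i) ^+ 4.
Proof. by rewrite (big_morph _ (exp4D_char2 char2) (expr0n _ 4)). Qed.

(* Multiplying r ^ 6 + y ^ 6 + y r = 0 by the fifth power of the cofactor of r
   and summing over the conjugates. *)
Lemma trace_inv5_5 (z : k) : 5.-primitive_root z ->
  dil (24 * 5 ^ 2) phi ^+ 5 + res 5 (etainv 5 ^+ 5) = dil (24 * 5) (phi ^+ 25).
Proof.
move=> prim_z; rewrite dilX //.
have y_nz : dil 5 eta != 0 by apply: dil_eta_neq0.
have := y_nz; rewrite (@dil_eta 5 isT) => y_nz'.
have S1 : \sum_(u <- conjugates 5 z) u.2 = dil (24 * 5) phi ^+ 5.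
  by rewrite (sum_conj_inv (l := 5)) // (trace_inv5 prim_z) dilX.
rewrite -(sum_conj_invX (l := 5) _ prim_z) //.
apply: solve_trace5_5 y_nz' (dil_phi (_ : 0 < 24 * 5)%N) S1 _ => //.
rewrite -(@dil_eta 5 isT) -sum_exp4 !mulr_sumr.
(* With m = t^25 and r' = m / r, the product of the equation with r'^5 reads y^6 r'^5 = m^5 r + y m
   r'^4. The sum of the r vanishes since X^6 + y X + y^6 has no term in X^5, and the fourth powers
   sum by Frobenius. *)
have e0 : \sum_(u <- conjugates 5 z) (t ^+ 5) ^+ 5 ^+ 5 * u.1 = 0.
  rewrite -mulr_sumr (sum_conj_eta (l := 5) (L := [::]) isT prim_z isT isT (eta_modeq5 char2)).
  by rewrite coef_modpoly big_nil !mulr0n !addr0 oppr0 mulr0.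
rewrite -[RHS]addr0 -[X in _ = _ + X]e0 -big_split /= !big_seq.
apply: eq_bigr => u conj_u; have := conjugate_mul (l := 5) isT prim_z conj_u.
have -> : t ^+ (5 ^ 2) = (t ^+ 5) ^+ 5 by rewrite -exprM mulnn.
move=> <-; have := conjugate_root (l := 5) (L := [::]) isT prim_z isT (eta_modeq5 char2) conj_u.
rewrite /modeq big_nil addr0 -addrA => /(eq_adda char2) ->.
by ring.
Qed.

Lemma psi_eq m n : ((psi k)@_m != 0 <-> (psi k)@_n != 0) -> (psi k)@_m = (psi k)@_n.
Proof.
case: (psi01 k m) (psi01 k n) => -> [] -> //; rewrite eqxx oner_eq0 => -[h1 h2].
  by have := h2 isT.
by have := h1 isT.
Qed.

Lemma psi_neq0E n : (psi k)@_n != 0 <-> exists2 a, odd a & n = (a ^ 2)%N.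
Proof.
by split=> [/psi_neq0 // | [a odd_a ->]]; rewrite psi_sqr // oner_neq0.
Qed.

(** If 7 divides 3 a^2, it divides a; the surviving exponents are therefore 49 * 3 c^2 with c
    odd. *)
Lemma res7_psi : res 7 (dil 3 (psi k)) = dil 49 (dil 3 (psi k)).
Proof.
rewrite dil_dil //; apply/fpsP => n; rewrite coef_res !coef_dil.
have dvd7 a : (7 %| a ^ 2 -> 7 %| a)%N by rewrite Euclid_dvdX // andbT.
have [/dvdnP[j ->]|ndv] := boolP (49 * 3 %| n)%N.
  have -> : (7 %| j * (49 * 3))%N by lia.
  have -> : (3 %| j * (49 * 3))%N by lia.
  rewrite mulnK // mulnA mulnK //; apply: psi_eq; rewrite !psi_neq0E.
  split=> -[a odd_a ea]; last by exists (7 * a)%N; rewrite ?oddM ?odd_a // ea; lia.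
  have /dvdnP[c ac] : (7 %| a)%N by apply: dvd7; rewrite -ea; lia.
  exists c; first by move: odd_a; rewrite ac oddM => /andP[].
  by move: ea; rewrite ac; lia.
case: ifP => // dv7; case: ifP => // dv3; apply/eqP; apply: contraNT ndv.
move/psi_neq0 => [a _ ea]; have /dvdnP[c ac] : (7 %| a)%N.
  by apply: dvd7; rewrite -ea; lia.
have : (n = 3 * a ^ 2)%N by rewrite -ea; lia.
by rewrite ac => ->; apply/dvdnP; exists (c ^ 2)%N; lia.
Qed.

(** Multiplying the equation by r' = m / r gives y^8 r' = m r^7 + m y + m y^4 r^3 for each conjugate
    r. Summed over the eight conjugates, the term m y vanishes, the cubes vanish by [eta_cube] and
    [res7_psi], and the left side is m y by [trace_inv]. *)
Lemma trace_eta7 (z : k) : 7.-primitive_root z ->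
  dil 49 eta ^+ 7 + res 7 (eta ^+ 7) = dil 7 eta.
Proof.
move=> prim_z; have m7 := eta_modeq7 char2.
have e49 : dil 7 (dil 7 eta) = dil 49 eta by apply: dil_dil.
have eS7 := sum_conj_etaX (l := 7) isT prim_z 7; rewrite e49 in eS7; rewrite -eS7.
have S3 : \sum_(u <- conjugates 7 z) u.1 ^+ 3 = 0.
  rewrite (sum_conj_etaX (l := 7) isT prim_z 3) e49 -dilX // eta_cube //.
  by rewrite res7_psi addaa.
have SV := trace_inv (l := 7) (L := modeq7_terms) isT isT prim_z isT isT m7.
rewrite -big_filter [filter _ _](_ : _ = [::]) // big_nil addr0 -(sum_conj_inv (l := 7) isT prim_z) in SV.
have m_nz : t ^+ (7 ^ 2) != 0 by rewrite expf_neq0 ?tX_neq0.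
apply: (mulfI m_nz); rewrite -SV !mulr_sumr.
move: (t ^+ (7 ^ 2)) (@conjugate_mul 7 z isT prim_z) => m mE.
transitivity (\sum_(u <- conjugates 7 z) (m * u.1 ^+ 7 + m * dil 7 eta
                  + m * dil 7 eta ^+ 4 * u.1 ^+ 3)); last first.
  rewrite !big_seq; apply: eq_bigr => u conj_u.
  have := conjugate_root (l := 7) (L := modeq7_terms) isT prim_z isT m7 conj_u.
  rewrite /modeq big_seq1 -!addrA => /(eq_adda char2) ->.
  by rewrite -(mE u) //; ring.
have SC : \sum_(u <- conjugates 7 z) dil 7 eta = 0.
  rewrite big_const_seq count_predT iter_addr_0 (_ : size _ = 2 * 4)%N //.
  by rewrite mulrnA mulr2n addaa // mul0rn.
by rewrite !big_split /= -!mulr_sumr S3 SC !mulr0 !addr0.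
Qed.

End Traces.

(** * Coefficients in progressions and supports of E and E^3 *)

Section Coefficients.
Local Open Scope ring_scope.
Variable k : fieldType.
Hypothesis char2 : 2%N \in [pchar k].
Local Notation t := (tX k).
Local Notation E := (euler k).
Local Notation phi := (euler k)^-1.

Lemma addkk (c : k) : c + c = 0. Proof. exact: addrr_pchar2 char2 c. Qed.

Lemma eq_coef (a b : fps k) n : a = b -> a@_n = b@_n. Proof. by move->. Qed.

Lemma coef_trace5 (z : k) N : 5.-primitive_root z ->
  phi@_(5 * N + 4) = (phi ^+ 5 + dil 5 phi)@_N.+1.
Proof.
move=> prim_z; have := eq_coef (24 * 5 * N.+1) (trace_inv5 char2 prim_z).
rewrite (@coef_sum_inv k 5 isT 1 N.+1 erefl) coef_dil_mul // fcoefD => <-.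
rewrite ltnNge muln_gt0 /= addrAC addkk add0r; congr (_ @_ _); lia.
Qed.

Lemma coef_trace5_5 (z : k) M : 5.-primitive_root z ->
  (phi ^+ 5)@_(5 * M) = (phi ^+ 25 + (dil 5 phi) ^+ 5)@_M.+1.
Proof.
move=> prim_z; have := eq_coef (24 * 5 * M.+1) (trace_inv5_5 char2 prim_z).
rewrite (coef_dil_mul (phi ^+ 25) _ (_ : 0 < 24 * 5)%N) // fcoefD => e; rewrite fcoefD -{}e.
have -> : dil (24 * 5 ^ 2) phi = dil (24 * 5) (dil 5 phi) by rewrite dil_dil.
rewrite -[X in X@_ _ + _](dilX _ _ (_ : 0 < 24 * 5)%N) // (coef_dil_mul _ _ (_ : 0 < 24 * 5)%N) //.
rewrite addrAC addkk add0r coef_res [X in if X then _ else _](_ : _ = true); last by lia.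
rewrite /etainv exprMn -dilX // -exprM coef_tXnM ifF; last by lia.
by rewrite (_ : _ - _ = 24 * (5 * M))%N ?coef_dil_mul //; lia.
Qed.

(** Two steps of level 5, since 25 m + 24 = 5 (5 m + 4) + 4. The first produces phi^5 and phi(q^5)
    at 5 (m + 1); the second resolves phi^5, while phi(q^5) contributes q phi. *)
Lemma coef_trace25 (z : k) m : 5.-primitive_root z ->
  phi@_(25 * m + 24) = (phi ^+ 25 + t * phi + (dil 5 phi) ^+ 5)@_m.+2.
Proof.
move=> prim_z; rewrite (_ : 25 * m + 24 = 5 * (5 * m + 4) + 4)%N; last by lia.
rewrite (coef_trace5 _ prim_z) (_ : (5 * m + 4).+1 = 5 * m.+1)%N; last by lia.
by rewrite fcoefD (coef_trace5_5 _ prim_z) coef_dil_mul // !fcoefD coef_tXM addrAC.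
Qed.

Lemma coef_trace29 (z : k) m : 29.-primitive_root z ->
  phi@_(29 * m + 23) = (phi ^+ 29 + t * phi ^+ 5 + dil 29 phi)@_m.+2.
Proof.
move=> prim_z; have := eq_coef (24 * 29 * m.+2) (trace_inv29 char2 prim_z).
rewrite (@coef_sum_inv k 29 isT 35 m.+2 erefl) coef_dil_mul // => e; rewrite [RHS]fcoefD -{}e.
rewrite ifF; last by lia.
by rewrite addrAC addkk add0r; congr (_ @_ _); lia.
Qed.

Lemma coef_trace7 (z : k) M : 7.-primitive_root z ->
  (E ^+ 7)@_(7 * M) = (E + t ^+ 2 * dil 7 (E ^+ 7))@_M.
Proof.
move=> prim_z; have := eq_coef (7 + 24 * 7 * M) (trace_eta7 char2 prim_z).
have -> : dil 49 (eta24 k) ^+ 7 = t ^+ 7 * dil (24 * 7) (t ^+ 2 * dil 7 (E ^+ 7)).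
  have h : (0 < 24 * 7)%N by [].
  rewrite (dil_eta char2 (_ : 0 < 49)%N) // exprMn -exprM (dilM _ _ h) (dilX _ _ h).
  rewrite (dil_tX _ h) -exprM mulrA -exprD (dil_dil _ h (_ : 0 < 7)%N) // -mulnA.
  by rewrite dilX.
have eE : eta24 k ^+ 7 = t ^+ 7 * dil 24 (E ^+ 7) by rewrite eta24_euler // exprMn dilX.
have e7 : (7 %| 7 + 24 * 7 * M)%N by lia.
rewrite [X in X = _ -> _]fcoefD coef_res e7 eE (dil_eta char2 (_ : 0 < 7)%N) //.
have lt7 : (7 + 24 * 7 * M < 7)%N = false by lia.
rewrite !coef_tXnM lt7 addKn.
rewrite !(coef_dil_mul _ _ (_ : 0 < 24 * 7)%N) // -mulnA coef_dil_mul // => e.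
by rewrite fcoefD -{}e addrAC addkk add0r.
Qed.

(** The exponent 24 n + 1 is not divisible by 9, so only psi(t) contributes to eta there. *)
Lemma euler_neq0 n : E@_n != 0 -> exists a, (24 * n + 1 = a ^ 2)%N.
Proof.
have -> : E@_n = (eta24 k)@_(24 * n + 1).
  by rewrite eta24_euler // addn1 coef_tXM coef_dil_mul.
rewrite fcoefD coef_dil [(9 %| _)%N](_ : _ = false) ?addr0; last by lia.
by move/psi_neq0 => [a _ ->]; exists a.
Qed.

Lemma euler3_neq0 n : (E ^+ 3)@_n != 0 -> exists a, (8 * n + 1 = a ^ 2)%N.
Proof.
have -> : (E ^+ 3)@_n = (eta24 k ^+ 3)@_(24 * n + 3).
  rewrite eta24_euler // exprMn coef_tXnM ifF; last by lia.
  by rewrite addnK -dilX // coef_dil_mul.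
rewrite eta_cube // (_ : 24 * n + 3 = 3 * (8 * n + 1))%N ?coef_dil_mul //; last by lia.
by move/psi_neq0 => [a _ ->]; exists a.
Qed.

End Coefficients.

(** * Partitions *)

Section PartitionLists.
Variables (n : nat) (Q : pred (seq nat)).
Hypothesis Qpart : forall s, Q s -> is_partition s && (sumn s <= n).

(** The finite type of bounded partitions depends on n. Plain lists allow partitions of different
    sizes to be compared. *)
Definition part_list : seq (seq nat) :=
  [seq parts u | u <- enum [set u : n.-bseq 'I_n.+1 | Q (parts u)]].

Lemma parts_inj : injective (@parts n).
Proof. by move=> u v /(inj_map val_inj)/val_inj. Qed.

Lemma mem_part_list s : (s \in part_list) = Q s.
Proof.
apply/mapP/idP => [[u] | Qs]; first by rewrite mem_enum inE => Qu ->.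
have /andP[ps le_s] := Qpart Qs; have [u us] := bounded_partition ps le_s.
by exists u; rewrite ?mem_enum ?inE us.
Qed.

Lemma uniq_part_list : uniq part_list.
Proof. by rewrite map_inj_uniq ?enum_uniq //; apply: parts_inj. Qed.

Lemma card_part_list l : uniq l -> (forall s, (s \in l) = Q s) ->
  #|[set u : n.-bseq 'I_n.+1 | Q (parts u)]| = size l.
Proof.
move=> uniq_l lQ; transitivity (size part_list); first by rewrite size_map -cardE.
by apply/perm_size/uniq_perm; rewrite ?uniq_part_list // => s; rewrite lQ mem_part_list.
Qed.

End PartitionLists.

Definition part_of (A : pred nat) (N n : nat) (s : seq nat) :=
  [&& is_partition s, sumn s == n, all A s & all (fun i => i <= N) s].

Definition pcount A N n := #|[set u : n.-bseq 'I_n.+1 | part_of A N n (parts u)]|.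

Lemma part_of_bound A N n s : part_of A N n s -> is_partition s && (sumn s <= n).
Proof. by case/and4P=> -> /eqP-> _ _; rewrite leqnn. Qed.

Lemma pcountE A N n m : n <= m ->
  pcount A N n = #|[set u : m.-bseq 'I_m.+1 | part_of A N n (parts u)]|.
Proof.
move=> le_nm; have b s : part_of A N n s -> is_partition s && (sumn s <= m).
  by move=> /part_of_bound/andP[-> /leq_trans]; apply.
rewrite /pcount (card_part_list (@part_of_bound A N n) (uniq_part_list m (part_of A N n))).
  by rewrite size_map -cardE.
by move=> s; apply: mem_part_list.
Qed.

Lemma pcount0 A n : pcount A 0 n = (n == 0).
Proof.
rewrite /pcount (@card_part_list _ _ _ (if n is 0 then [:: [::]] else [::])).
- by case: n.
- exact: part_of_bound.
- by case: n.
move=> s; apply/idP/idP.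
  by case: n => //; rewrite inE => /eqP ->.
case/and4P=> /andP[_ s0] /eqP sn _ /allP le0.
case: s s0 sn le0 => [_ /= <- //|i s]; rewrite inE negb_or => /andP[i0 _] _ /(_ i (mem_head i s)).
by rewrite leqn0 eq_sym (negPf i0).
Qed.

Lemma geq_transitive : transitive geq.
Proof. by move=> y x z le_yx le_zy; apply: leq_trans le_yx. Qed.

Lemma part_of_cons A N n i s : part_of A N n (i :: s) =
  [&& 0 < i, A i, i <= N, i <= n & part_of A i (n - i) s].
Proof.
rewrite /part_of /is_partition /= (path_sortedE geq_transitive) inE negb_or eq_sym -lt0n.
have -> : (i + sumn s == n) = (i <= n) && (sumn s == n - i).
  by apply/eqP/andP => [<-|[le /eqP ->]]; rewrite ?leq_addr ?addKn ?subnKC.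
have e : all (geq i) s = all (fun j => j <= i) s by [].
rewrite e; case: (leqP i N) => leN; last by rewrite !andbF.
case si: (all _ s); last by rewrite !andbF.
have -> : all (fun j => j <= N) s by apply: sub_all si => j; move/leq_trans; apply.
rewrite !andbT /=; case: (0 < i); case: (A i); rewrite ?andbF //=.
by rewrite -!andbA; case: (i <= n); rewrite ?andbF.
Qed.

(** Either no part equals N + 1, or the largest part does and one copy of it is removed. *)
Lemma pcountS A N n : pcount A N.+1 n =
  pcount A N n + (if A N.+1 && (N < n) then pcount A N.+1 (n - N.+1) else 0).
Proof.
pose l1 := part_list n (part_of A N n).
pose l2 := if A N.+1 && (N < n) then
  [seq N.+1 :: s | s <- part_list (n - N.+1) (part_of A N.+1 (n - N.+1))] else [::].
have m1 s : (s \in l1) = part_of A N n s by apply: mem_part_list; apply: part_of_bound.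
have m2 s : (s \in l2) = [&& A N.+1, N < n, head 0 s == N.+1
                           & part_of A N.+1 (n - N.+1) (behead s)].
  rewrite /l2; case: ifP => [/andP[-> ->] /= | /negbT]; last first.
    by rewrite negb_and => /orP[] /negPf->; rewrite ?andbF.
  have mm s' := @mem_part_list _ _ (@part_of_bound A N.+1 (n - N.+1)) s'.
  apply/mapP/andP => [[s' ls' ->] | [/eqP hs ps]]; first by rewrite eqxx -mm.
  by case: s hs ps => //= i s -> ps; exists s; rewrite ?mm.
rewrite /pcount (@card_part_list _ _ (@part_of_bound A N.+1 n) (l1 ++ l2)).
- rewrite size_cat size_map -cardE /l2; congr (_ + _); case: ifP => // _.
  by rewrite !size_map -cardE.
- rewrite cat_uniq uniq_part_list /=; apply/andP; split.
    apply/hasPn => s; rewrite m2 m1 => /and4P[_ _ /eqP hs _].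
    by case: s hs => //= i s ->; rewrite part_of_cons ltnn !andbF.
  rewrite /l2; case: ifP => // _; rewrite map_inj_uniq ?uniq_part_list // => s s' [].
  by [].
move=> s; rewrite mem_cat m1 m2; case: s => [|i s] /=; first by rewrite !andbF orbF.
rewrite !part_of_cons; case: (ltngtP i N.+1) => [||->].
- by rewrite ltnS => ->; rewrite !andbF orbF.
- by move=> lt; rewrite !andbF orbF (leqNgt i N) (ltnW lt) !andbF.
by rewrite ltnn !andbF.
Qed.

(** * Generating functions of b and p modulo 2 *)

Section GeneratingFunctions.
Local Open Scope ring_scope.
Variable k : fieldType.
Hypothesis char2 : 2%N \in [pchar k].
Local Notation t := (tX k).
Local Notation E := (euler k).
Local Notation phi := (euler k)^-1.

Definition pseries A N : fps k := Fps (fun n => (pcount A N n)%:R).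

Definition part_prod (A : pred nat) N : fps k := \prod_(0 <= i < N | A i.+1) (1 + t ^+ i.+1).

Lemma coef_pseries A N n : (pseries A N)@_n = (pcount A N n)%:R.
Proof. by []. Qed.

Lemma pseriesS A N : (1 + (if A N.+1 then t ^+ N.+1 else 0)) * pseries A N.+1 = pseries A N.
Proof.
rewrite mulrDl mul1r; apply/fpsP => n; rewrite fcoefD !coef_pseries pcountS.
case: (A N.+1); last by rewrite mul0r fcoef0 addr0 addn0.
rewrite andTb coef_tXnM !coef_pseries (ltnS n N) (leqNgt n N).
move: (pcount A N n) (pcount A N.+1 _) => c d.
case: (N < n)%N; last by rewrite addn0 addr0.
by rewrite natrD -addrA (addkk char2) addr0.
Qed.

Lemma pseries_prod A N : part_prod A N * pseries A N = 1.
Proof.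
elim: N => [|N IHN].
  rewrite /part_prod big_geq // mul1r; apply/fpsP => n; rewrite fcoef1 /= pcount0.
  by case: n.
rewrite -[RHS]IHN -(pseriesS A N) /part_prod big_mkcond big_nat_recr //= -big_mkcond /=.
by rewrite -mulrA; congr (_ * (_ * _)); case: ifP; rewrite ?addr0.
Qed.

(** The factors of the excluded parts complete the product over the allowed ones to a partial Euler
    product. *)
Lemma pseries_phi A N : eqm N.+1 (pseries A N) (part_prod (predC A) N * phi).
Proof.
have eP : part_prod A N * part_prod (predC A) N = eprod k 0 N.
  by rewrite /eprod (bigID (fun i => A i.+1)).
rewrite -[pseries A N]mulr1 -(mulrV (euler_unit k)) mulrA; apply: eqmM; last exact: eqm_refl.
rewrite -[part_prod (predC A) N]mul1r -(pseries_prod A N) [part_prod A N * _]mulrC -mulrA eP.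
by apply: eqmM; [apply: eqm_refl | apply: euler_eqm].
Qed.

Lemma part_prod_dvd m N : (0 < m)%N ->
  eqm N.+1 (part_prod (fun i => (m %| i)%N) N) (dil m E).
Proof.
move=> m_gt0; have -> : part_prod (fun i => (m %| i)%N) N = dil m (eprod k 0 (N %/ m)).
  elim: N => [|N IHN].
    by rewrite div0n /part_prod /eprod !big_geq // dil1.
  rewrite /part_prod big_mkcond big_nat_recr //= -big_mkcond /= -/(part_prod _ N) IHN divnS //.
  case: ifP => [/dvdnP[q e]|_]; last by rewrite mulr1 add0n.
  rewrite add1n /eprod big_nat_recr //= dilM // dilD dil1 dilX // dil_tX // -exprM.
  have -> : (m * (N %/ m).+1 = N.+1)%N; last by [].
  by move: (divnS N m_gt0); rewrite e dvdn_mull // mulnK // add1n => <-; rewrite mulnC.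
rewrite /eqm -dilB; apply: (ordgeW (m := (m * (N %/ m).+1)%N)).
  by rewrite mulnC ltn_ceil.
by apply/ordge_dil/eqm_sym/euler_eqm.
Qed.

Lemma coef_b m n : (0 < m)%N -> (b m n)%:R = (dil m E * phi)@_n.
Proof.
move=> m_gt0; pose A i := ~~ (m %| i)%N.
have -> : b m n = pcount A n n.
  apply: eq_card => u; rewrite !inE /part_of; congr (_ && (_ && _)).
  rewrite [X in _ && X](_ : _ = true) ?andbT //; apply/allP => i /mapP[j _ ->].
  by rewrite -ltnS ltn_ord.
transitivity ((pseries A n)@_n) => //.
have /eqmP/(_ n (ltnSn n)) -> := @pseries_phi A n.
suff /eqmP-> : eqm n.+1 (part_prod (predC A) n * phi) (dil m E * phi) by [].
apply: eqmM; last exact: eqm_refl.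
have -> : part_prod (predC A) n = part_prod (fun i => m %| i)%N n.
  by apply: eq_bigl => i /=; rewrite negbK.
exact: part_prod_dvd.
Qed.

Lemma leq_mem_sumn (s : seq nat) j : j \in s -> (j <= sumn s)%N.
Proof. by move=> js; rewrite (perm_sumn (perm_to_rem js)) leq_addr. Qed.

(** Distributivity expands the r-th power of a sum over partitions into a sum over functions from r
    indices to partitions, which correspond to tuples. *)
Lemma coef_p r n : (p r n)%:R = (phi ^+ r)@_n.
Proof.
pose U := (n.-bseq 'I_n.+1)%type; pose Q (u : U) := is_partition (parts u).
(* The type also contains partitions of size larger than n, so G is compared with phi only up to
   exponent n. *)
pose G : fps k := \sum_(u : U | Q u) t ^+ sumn (parts u).
have Gphi : eqm n.+1 G phi.
  apply/eqmP => i; rewrite ltnS => le_in.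
  have part1 : part_prod (predC predT) i = 1 by rewrite /part_prod big_pred0.
  have /eqmP/(_ i (ltnSn i)) := @pseries_phi predT i; rewrite part1 mul1r => <-.
  rewrite coef_pseries (pcountE _ _ le_in) /G fcoef_sum -sum1_card natr_sum.
  rewrite [LHS]big_mkcond [RHS]big_mkcond; apply: eq_bigr => u _.
  rewrite inE /part_of all_predT coef_tXn eq_sym /Q.
  case: (is_partition _) => //=; case: eqP => //= su; case: ifP => // /negP[]; apply/allP => j ju.
  by rewrite -su leq_mem_sumn.
have /eqmP/(_ n (ltnSn n)) <- := eqmX r Gphi.
rewrite /p -sum1_card natr_sum.
have -> : G ^+ r = \prod_(i < r) G by rewrite prodr_const card_ord.
rewrite bigA_distr_big fcoef_sum.
pose h (f : {ffun 'I_r -> U}) : r.-tuple U := [tuple f i | i < r].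
have hK : bijective h.
  exists (fun w : r.-tuple U => [ffun i => tnth w i]) => [f|w].
    by apply/ffunP => i; rewrite ffunE tnth_mktuple.
  by apply/eq_from_tnth => i; rewrite tnth_mktuple ffunE.
rewrite (reindex h) /=; last exact: onW_bij hK.
rewrite big_mkcond [RHS]big_mkcond; apply: eq_bigr => f _.

rewrite inE prodrXr coef_tXn eq_sym.
have -> : (f \in ffun_on Q) = all (fun u => is_partition (parts u)) (h f).
  apply/ffun_onP/all_tnthP => Qf i; first by rewrite tnth_mktuple; apply: Qf.
  by have := Qf i; rewrite tnth_mktuple.
case: (all _ _) => //=.
under eq_bigr do rewrite tnth_mktuple.
by case: eqP.
Qed.

End GeneratingFunctions.

(** * Arithmetic progressions *)

Section Progressions.
Local Open Scope ring_scope.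
Variable k : fieldType.
Implicit Types a f g : fps k.

Definition prog l r a : fps k := Fps (fun n => a@_(l * n + r)).

Lemma coef_prog l r a n : (prog l r a)@_n = a@_(l * n + r). Proof. by []. Qed.

Lemma coef_tXn_dil l r s f n : (r < l)%N -> (s < l)%N ->
  (tX k ^+ s * dil l f)@_(l * n + r) = if s == r then f@_n else 0.
Proof.
move=> lt_rl lt_sl; rewrite coef_tXnM coef_dil; have l_gt0 := leq_ltn_trans (leq0n r) lt_rl.
have [->|ne_sr] := eqVneq s r; first by rewrite ltnNge leq_addl addnK dvdn_mulr ?mulKn.
case: ltnP => // le_s; case: ifP => // /dvdnP[q /(congr1 (addn^~ s))]; rewrite subnK //.
move/(congr1 (modn^~ l)); rewrite mulnC !modnMDl !modn_small // => /esym/eqP.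
by rewrite (negPf ne_sr).
Qed.

Lemma prog_sum l a : (0 < l)%N -> a = \sum_(s < l) tX k ^+ s * dil l (prog l s a).
Proof.
move=> l_gt0; apply/fpsP => n; rewrite (divn_eq n l) fcoef_sum.
move: (n %/ l)%N (n %% l)%N (ltn_pmod n l_gt0) => q r lt_rl; rewrite [(q * l)%N]mulnC.
rewrite (bigD1 (Ordinal lt_rl)) // [X in _ = X + _](coef_tXn_dil _ _ lt_rl lt_rl) eqxx coef_prog.
rewrite big1 ?addr0 // => s ne_s; rewrite coef_tXn_dil // ifF //.
by apply: contraNF ne_s.
Qed.

(** Multiplication by a series in q^l preserves exponents modulo l, so such a factor can be taken
    out of the extraction of a residue class. *)
Lemma coef_dilM_prog l r g a n : (r < l)%N ->
  (dil l g * a)@_(l * n + r) = (g * prog l r a)@_n.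
Proof.
move=> lt_rl; have l_gt0 := leq_ltn_trans (leq0n r) lt_rl.
rewrite {1}(prog_sum a l_gt0) mulr_sumr fcoef_sum (bigD1 (Ordinal lt_rl)) // mulrCA -dilM //.
rewrite [X in X + _ = _](coef_tXn_dil _ _ lt_rl lt_rl) eqxx big1 ?addr0 // => s ne_s.
by rewrite mulrCA -dilM // coef_tXn_dil // ifF //; apply: contraNF ne_s.
Qed.

Lemma coefM_eq0 a f N :
  (forall i j, (i + j)%N = N -> a@_i != 0 -> f@_j != 0 -> False) -> (a * f)@_N = 0.
Proof.
move=> h; rewrite fcoefM big1 // => i _; apply/eqP; rewrite mulf_eq0; apply/orP.
have [|a0] := eqVneq a@_i 0; first by left.
have [|f0] := eqVneq f@_(N - i) 0; first by right.
by have := h i (N - i)%N (subnKC (ltn_ord i : i <= N)%N) a0 f0.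
Qed.

Lemma tX2_shift a f : f@_0 = 0 -> f@_1 = 0 -> (forall n, a@_n = f@_n.+2) -> f = tX k ^+ 2 * a.
Proof. by move=> f0 f1 fa; apply/fpsP => -[|[|n]]; rewrite coef_tXnM //= subn2 fa. Qed.

Lemma coef0X a n : a@_0 = 1 -> (a ^+ n)@_0 = 1.
Proof. by move=> a0; rewrite fcoefX0 a0 expr1n. Qed.

Lemma coef1X a n : a@_0 = 1 -> (a ^+ n)@_1 = n%:R * a@_1.
Proof.
move=> a0; elim: n => [|n IHn]; first by rewrite expr0 fcoef1 mul0r.
by rewrite exprS fcoefM big_ord_recr big_ord1 /= IHn a0 coef0X // mul1r mulr1 -nat1r mulrDl mul1r addrC.
Qed.

End Progressions.

(** * Vanishing of coefficients by quadratic residues *)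

Section Vanishing.
Local Open Scope ring_scope.
Variable k : fieldType.
Hypothesis char2 : 2%N \in [pchar k].
Local Notation t := (tX k).
Local Notation E := (euler k).
Local Notation phi := (euler k)^-1.

(** The residues of c x^2 modulo m as an explicit list, so that avoiding them is decided by
    computation. *)
Definition qvals (m c : nat) : seq nat := [seq (c * x ^ 2 %% m)%N | x <- iota 0 m].

Lemma mem_qvals m c x : (0 < m)%N -> (c * x ^ 2 %% m)%N \in qvals m c.
Proof.
move=> m_gt0; apply/mapP; exists (x %% m)%N; first by rewrite mem_iota ltn_mod.
by rewrite -[RHS]modnMmr modnXm modnMmr.
Qed.

Lemma isF2_euler : isF2 E.
Proof.
move=> n; suff h : isF2 (eprod k 0 n) by apply: h.
rewrite /eprod; apply: big_ind => [||i _]; [exact: isF2_1 | exact: isF2M |].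
by apply: isF2D => //; [exact: isF2_1 | apply/isF2X/isF2_tX].
Qed.

Lemma frobenius_iter (a : fps k) j : isF2 a -> a ^+ (2 ^ j) = dil (2 ^ j) a.
Proof.
move=> aF; elim: j => [|j IHj].
  by apply/fpsP => n; rewrite coef_dil dvd1n divn1.
rewrite expnSr exprM IHj frobenius_F2 // ?dil_dil ?expn_gt0 //; last exact: isF2_dil.
by rewrite mulnC.
Qed.

Lemma euler_eq0 m N : (0 < m)%N -> ((24 * N + 1) %% m)%N \notin qvals m 1 -> E@_N = 0.
Proof.
move=> m_gt0 h; apply/eqP; apply: contraNT h => /(euler_neq0 char2)[a ->].
by rewrite -(mul1n (a ^ 2)%N) mem_qvals.
Qed.

Lemma euler3_eq0 m N : (0 < m)%N -> ((8 * N + 1) %% m)%N \notin qvals m 1 -> (E ^+ 3)@_N = 0.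
Proof.
move=> m_gt0 h; apply/eqP; apply: contraNT h => /(euler3_neq0 char2)[a ->].
by rewrite -(mul1n (a ^ 2)%N) mem_qvals.
Qed.

Lemma dil_neq0 m (a : fps k) n : (dil m a)@_n != 0 -> exists2 q, n = (m * q)%N & a@_q != 0.
Proof.
rewrite coef_dil; case: ifP => [|_]; last by rewrite eqxx.
case/dvdnP=> q ->; case: (posnP m) => [->|m_gt0]; last by rewrite mulnK // mulnC; exists q.
by rewrite muln0 divn0; exists 0%N; rewrite ?mul0n.
Qed.

(** A contributing exponent is N = c e + l d with 24 e + 1 = a^2, so 24 N + c is congruent to c a^2
    modulo l. *)
Lemma dil_euler_eq0 c l (f : fps k) N : (0 < l)%N ->
  ((24 * N + c) %% l)%N \notin qvals l c -> (dil c E * dil l f)@_N = 0.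
Proof.
move=> l_gt0 h; apply: coefM_eq0 => i j eN /dil_neq0[e ei /(euler_neq0 char2)[a ea]] /dil_neq0[d ed _].
case/negP: h; rewrite (_ : 24 * N + c = 24 * d * l + c * (24 * e + 1))%N; last first.
  by rewrite -eN ei ed; ring.
by rewrite ea modnMDl mem_qvals.
Qed.

(** A contributing exponent is N = i + c d with 8 i + 1 and 8 d + 1 squares, so 8 N + 1 + c is a
    square plus c times a square. *)
Lemma euler3_dil_eq0 m c N : (0 < m)%N ->
  ((8 * N + (1 + c)) %% m)%N \notin [seq (x + y) %% m | x <- qvals m 1, y <- qvals m c]%N ->
  (E ^+ 3 * dil c (E ^+ 3))@_N = 0.
Proof.
move=> m_gt0 h; apply: coefM_eq0 => i j eN /(euler3_neq0 char2)[a ea].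
move=> /dil_neq0[d ed /(euler3_neq0 char2)[f ef]]; case/negP: h.
apply/allpairsP; exists ((1 * a ^ 2) %% m, (c * f ^ 2) %% m)%N; rewrite /= !mem_qvals //.
rewrite modnDm -ea -ef mul1n -eN ed; split=> //; congr (_ %% m)%N; ring.
Qed.

Lemma euler1 : E@_1 = 1.
Proof. by rewrite /= /eprod big_nat1 fcoefD fcoef1 coef_tXn add0r. Qed.

Lemma phi0 : phi@_0 = 1.
Proof.
have := eq_coef 0 (mulrV (euler_unit k)).
by rewrite fcoefM0 euler0 mul1r fcoef1.
Qed.

Lemma phi1 : phi@_1 = 1.
Proof.
have := eq_coef 1 (mulrV (euler_unit k)); rewrite fcoefM big_ord_recr big_ord1.
rewrite [X in X + _ = _](_ : _ = phi@_1); last by rewrite [X in X * _]euler0 mul1r.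
rewrite [X in _ + X = _](_ : _ = 1); last by rewrite [X in X * _]euler1 mul1r phi0.
by rewrite fcoef1 => /(congr1 (fun x => x + 1)); rewrite -addrA (addkk char2) addr0 add0r.
Qed.

Lemma coef01_phiX n : odd n -> (phi ^+ n)@_0 = 1 /\ (phi ^+ n)@_1 = 1.
Proof.
by move=> odd_n; rewrite coef0X ?coef1X ?phi0 // phi1 mulr1 natr_odd // odd_n.
Qed.

Lemma euler_phiX c n : E ^+ c * phi ^+ (c + n) = phi ^+ n.
Proof. by rewrite exprD mulrA -exprMn mulrV ?euler_unit // expr1n mul1r. Qed.

(** Packs [coef_trace25] into an identity of series that can be multiplied by powers of E. The
    coefficients at 0 and 1 on the left cancel in pairs, all being 1. *)
Lemma trace25_shift (z : k) : 5.-primitive_root z ->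
  phi ^+ 25 + t * phi + dil 5 phi ^+ 5 = t ^+ 2 * prog 25 24 phi.
Proof.
move=> prim_z; have [a0 a1] := coef01_phiX (isT : odd 25).
have d : dil 5 phi ^+ 5 = dil 5 (phi ^+ 5) by rewrite dilX.
have [b0 _] := coef01_phiX (isT : odd 5).
apply: tX2_shift => [||n]; last by rewrite coef_prog (coef_trace25 char2 _ prim_z).
- by rewrite d !fcoefD a0 coef_tXM (coef_dil_mul (phi ^+ 5) 0 (isT : 0 < 5)%N) b0 addr0 (addkk char2).
by rewrite d !fcoefD a1 coef_tXM phi0 (addkk char2) add0r.
Qed.

Lemma trace29_shift (z : k) : 29.-primitive_root z ->
  phi ^+ 29 + t * phi ^+ 5 + dil 29 phi = t ^+ 2 * prog 29 23 phi.
Proof.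
move=> prim_z; have [a0 a1] := coef01_phiX (isT : odd 29).
have [b0 _] := coef01_phiX (isT : odd 5).
apply: tX2_shift => [||n]; last by rewrite coef_prog (coef_trace29 char2 _ prim_z).
- by rewrite !fcoefD a0 coef_tXM (coef_dil_mul phi 0 (isT : 0 < 29)%N) phi0 addr0 (addkk char2).
by rewrite !fcoefD a1 coef_tXM b0 (addkk char2) add0r.
Qed.

Lemma odd_of_natr m n : m%:R = n%:R :> k -> odd m = odd n.
Proof.
rewrite (natr_odd char2 m) (natr_odd char2 n).
by case: (odd m); case: (odd n) => // /eqP; rewrite ?oner_eq0 // eq_sym oner_eq0.
Qed.

Lemma eq_mod2 m n : m%:R = n%:R :> k -> m = n %[mod 2].
Proof. by move/odd_of_natr => e; rewrite !modn2 e. Qed.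

(** Put c = 2^(j+1), so that E^c = E(q^c). In the trace identity times E^c, the term phi^25 gives
    phi^r. The hypothesis modulo 5 kills E(q^c) phi(q^5)^5, and the last hypothesis kills q
    E^(c-1). *)
Lemma b25 (z : k) j r N : 5.-primitive_root z -> (2 ^ j.+1 + r = 25)%N -> (1 < N)%N ->
  ((24 * N + 2 ^ j.+1) %% 5)%N \notin qvals 5 (2 ^ j.+1) ->
  (E ^+ (2 ^ j.+1).-1)@_N.-1 = 0 ->
  b (25 * 2 ^ j.+1) (25 * N - 26) = p r N %[mod 2].
Proof.
move=> prim_z er N_gt1 v5 vE; apply: eq_mod2; set c := (2 ^ j.+1)%N in er v5 vE *.
have c_gt0 : (0 < c)%N by rewrite expn_gt0.
rewrite (coef_b char2) ?muln_gt0 // coef_p //.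
rewrite (_ : 25 * N - 26 = 25 * (N - 2) + 24)%N; last by lia.
rewrite -dil_dil // coef_dilM_prog //.
have -> : (dil c E * prog 25 24 phi)@_(N - 2) = (dil c E * (t ^+ 2 * prog 25 24 phi))@_N.
  by rewrite mulrCA coef_tXnM ltnNge N_gt1.
rewrite -(trace25_shift prim_z) 2!mulrDr 2!fcoefD -{1 2}frobenius_iter; try exact: isF2_euler.
rewrite -er euler_phiX -(dilX 5 _ (isT : 0 < 5)%N) dil_euler_eq0 // addr0.
rewrite -[RHS]addr0; congr (_ + _); rewrite mulrCA coef_tXM.
have -> : E ^+ c * phi = E ^+ c.-1 by rewrite -{1}(prednK c_gt0) exprSr mulrK ?euler_unit.
by case: N N_gt1 vE {v5}.
Qed.

End Vanishing.

(** * The congruences *)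

Section Congruences.
Local Open Scope ring_scope.
Variable k : fieldType.
Hypothesis char2 : 2%N \in [pchar k].
Local Notation t := (tX k).
Local Notation E := (euler k).
Local Notation phi := (euler k)^-1.

(** As in [b25], with E^8: phi^29 becomes phi^21, and q phi^5 becomes q E^3, which is supported on 8
    n + 1 = a^2 before the shift by q. *)
Lemma b232 (z : k) N : 29.-primitive_root z -> (1 < N)%N ->
  ((24 * N + 8) %% 29)%N \notin qvals 29 8 -> ((8 * N.-1 + 1) %% 29)%N \notin qvals 29 1 ->
  b 232 (29 * N - 35) = p 21 N %[mod 2].
Proof.
move=> prim_z N_gt1 v29 vE; apply: (eq_mod2 char2).
rewrite (coef_b char2) // coef_p //.
rewrite (_ : 29 * N - 35 = 29 * (N - 2) + 23)%N; last by lia.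
have -> : dil 232 E = dil 29 (dil 8 E) by rewrite dil_dil.
rewrite coef_dilM_prog //.
have -> : (dil 8 E * prog 29 23 phi)@_(N - 2) = (dil 8 E * (t ^+ 2 * prog 29 23 phi))@_N.
  by rewrite mulrCA coef_tXnM ltnNge N_gt1.
rewrite -(trace29_shift char2 prim_z) 2!mulrDr 2!fcoefD (dil_euler_eq0 char2 _ _ v29) // addr0.
rewrite (_ : dil 8 E = E ^+ 8); last by rewrite (frobenius_iter char2 3) //; exact: isF2_euler.
rewrite (euler_phiX k 8 21) -[RHS]addr0; congr (_ + _); rewrite mulrCA coef_tXM.
have -> : E ^+ 8 * phi ^+ 5 = E ^+ 3.
  by rewrite (exprD _ 3 5) -mulrA -exprMn mulrV ?euler_unit // expr1n mulr1.
by case: N N_gt1 vE {v29} => // N _ /(euler3_eq0 char2 (isT : 0 < 29)%N).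
Qed.

(** By [coef_trace7] the coefficient is that of E + q^2 E(q^7)^7 at M. The first term vanishes by
    quadratic residues, the second because M is not 2 modulo 7. *)
Lemma euler7_eq0 (z : k) M : 7.-primitive_root z ->
  ((24 * M + 1) %% 7)%N \notin qvals 7 1 -> (M %% 7 != 2)%N -> (E ^+ 7)@_(7 * M) = 0.
Proof.
move=> prim_z vM M2; rewrite (coef_trace7 char2 _ prim_z) fcoefD (euler_eq0 char2 _ vM) // add0r.
rewrite coef_tXnM coef_dil; case: ltnP => // M_ge2; case: ifP => // /dvdnP[q eq].
by case/eqP: M2; rewrite -(subnK M_ge2) eq modnMDl.
Qed.

Lemma euler15_eq0 N :
  ((8 * N + 5) %% 9)%N \notin [seq (x + y) %% 9 | x <- qvals 9 1, y <- qvals 9 4]%N ->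
  (E ^+ 15)@_N = 0.
Proof.
move/(euler3_dil_eq0 char2 (isT : 0 < 9)%N) => <-; rewrite (exprD _ 3 12) (exprM _ 3 4).
by rewrite (frobenius_iter char2 2) //; apply/isF2X/isF2_euler.
Qed.

End Congruences.

(** In the field with 2^e elements, e the totient of n, the unit group is cyclic of order 2^e - 1, a
    multiple of n by Euler's theorem. *)
Lemma field_char2_prim_root n : odd n -> 0 < n ->
  exists k : fieldType, 2 \in [pchar k]%R /\ exists z : k, (n.-primitive_root z)%R.
Proof.
move=> odd_n n_gt0; have e_gt0 : 0 < totient n by rewrite totient_gt0.
have [k char2 cardk] := pPrimePowerField (isT : prime 2) e_gt0.
exists k; split=> //.
have q_gt1 : 1 < #|k| by rewrite cardk -(expn0 2) ltn_exp2l.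
pose rs := enum (predC1 (0 : k)%R); have szrs : size rs = #|k|.-1 by rewrite -cardE cardC1.
have : has (#|k|.-1).-primitive_root%R rs.
  apply: has_prim_root; rewrite ?enum_uniq ?szrs //; first by rewrite -subn1 subn_gt0.
  apply/allP => x; rewrite mem_enum inE => x0; apply/unity_rootP.
  by apply: (mulfI x0); rewrite mulr1 -exprS prednK ?expf_card // ltnW.
case/hasP=> x _ /dvdn_prim_root px; eexists; apply: px.
rewrite cardk -subn1 -eqn_mod_dvd ?expn_gt0 //.
by apply/eqP/Euler_exp_totient; rewrite coprime2n.
Qed.

Lemma mod_progression m M a c n B : m %| M -> (a * (M * n + B) + c) %% m = (a * B + c) %% m.
Proof.
case/dvdnP=> q ->; rewrite (_ : a * (q * m * n + B) + c = a * q * n * m + (a * B + c)).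
  by rewrite modnMDl.
by ring.
Qed.

(** The constants 26 and 35 are subtracted last: for every listed B the minuend is then larger, even
    at n = 0, and truncated subtraction agrees with the integer one. *)
Theorem theorem2 : forall n : nat,
  [/\ forall B : nat, B \in [:: 11; 18; 21; 26; 28; 33] ->
        b 50 (875 * n + 25 * B - 26) = p 23 (35 * n + B) %[mod 2],
      forall B : nat, B \in [:: 6; 12; 17; 26; 27; 31] ->
        b 100 (875 * n + 25 * B - 26) = p 21 (35 * n + B) %[mod 2],
      forall B : nat, B \in [:: 22; 29; 92; 127; 169; 239] ->
        b 200 (6125 * n + 25 * B - 26) = p 17 (245 * n + B) %[mod 2],
      forall B : nat, B \in [:: 3; 9; 18; 39] ->
        b 400 (1125 * n + 25 * B - 26) = p 9 (45 * n + B) %[mod 2]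
    & forall B : nat,
        B \in [:: 3; 6; 10; 12; 13; 14; 15; 18; 20; 23; 24; 25; 26; 28] ->
        b 232 (841 * n + 29 * B - 35) = p 21 (29 * n + B) %[mod 2]].
Proof.
move=> n; have [k [char2 [z prim_z]]] := @field_char2_prim_root (35 * 29) isT isT.
have prim5 := dvdn_prim_root prim_z (isT : 5 %| 35 * 29).
have prim7 := dvdn_prim_root prim_z (isT : 7 %| 35 * 29).
have prim29 := dvdn_prim_root prim_z (isT : 29 %| 35 * 29).
have predE M B : 0 < B -> (M * n + B).-1 = M * n + B.-1 by case: B => // B _; rewrite addnS.
have gt1E M B : 1 < B -> 1 < M * n + B by move/leq_trans; apply; rewrite leq_addl.
split=> B BL.
(* The progression has modulus 35 = 5 * 7, so the residue conditions modulo 5 and 7 depend on B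
   alone and are checked for each listed value. The other cases proceed in the same way. *)
- have /allP/(_ B BL)/and3P[B_gt1 v5 v7] : all (fun B => [&& 1 < B,
     (24 * B + 2) %% 5 \notin qvals 5 2 & (24 * B.-1 + 1) %% 7 \notin qvals 7 1])
     [:: 11; 18; 21; 26; 28; 33] by vm_compute.
  rewrite (_ : 875 * n + 25 * B = 25 * (35 * n + B)); last by rewrite mulnDr mulnA.
  apply: (b25 char2 (j := 0) prim5) => //; [exact: gt1E | by rewrite mod_progression |].
  by rewrite expr1 (euler_eq0 char2 (m := 7)) // predE ?mod_progression // ltnW.
- have /allP/(_ B BL)/and3P[B_gt1 v5 v7] : all (fun B => [&& 1 < B,
     (24 * B + 4) %% 5 \notin qvals 5 4 & (8 * B.-1 + 1) %% 7 \notin qvals 7 1])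
     [:: 6; 12; 17; 26; 27; 31] by vm_compute.
  rewrite (_ : 875 * n + 25 * B = 25 * (35 * n + B)); last by rewrite mulnDr mulnA.
  apply: (b25 char2 (j := 1) prim5) => //; [exact: gt1E | by rewrite mod_progression |].
  by rewrite (euler3_eq0 char2 (m := 7)) // predE ?mod_progression // ltnW.
(* Here B - 1 is a multiple of 7, so the exponent is 7 M with M = 35 n + (B - 1) / 7, as
   [euler7_eq0] requires. The form 1 * _ + 0 is made for [mod_progression]. *)
- have /allP/(_ B BL)/and5P[B_gt1 v5 B7 v7 B2] : all (fun B => [&& 1 < B,
     (24 * B + 8) %% 5 \notin qvals 5 8, B.-1 == 7 * (B.-1 %/ 7),
     (24 * (B.-1 %/ 7) + 1) %% 7 \notin qvals 7 1 & (1 * (B.-1 %/ 7) + 0) %% 7 != 2])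
     [:: 22; 29; 92; 127; 169; 239] by vm_compute.
  rewrite (_ : 6125 * n + 25 * B = 25 * (245 * n + B)); last by rewrite mulnDr mulnA.
  apply: (b25 char2 (j := 2) prim5) => //; [exact: gt1E | by rewrite mod_progression |].
  rewrite predE ?(ltnW B_gt1) // (eqP B7) (_ : 245 * n = 7 * (35 * n)) -?mulnDr; last by rewrite mulnA.
  rewrite (euler7_eq0 char2 prim7) ?mod_progression //.
  by rewrite -[35 * n + _]mul1n -[1 * _]addn0 mod_progression.
- have /allP/(_ B BL)/and3P[B_gt1 v5 v9] : all (fun B => [&& 1 < B,
     (24 * B + 16) %% 5 \notin qvals 5 16 & (8 * B.-1 + 5) %% 9 \notin
       [seq (x + y) %% 9 | x <- qvals 9 1, y <- qvals 9 4]])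
     [:: 3; 9; 18; 39] by vm_compute.
  rewrite (_ : 1125 * n + 25 * B = 25 * (45 * n + B)); last by rewrite mulnDr mulnA.
  apply: (b25 char2 (j := 3) prim5) => //; [exact: gt1E | by rewrite mod_progression |].
  by rewrite (euler15_eq0 char2) // predE ?mod_progression // ltnW.
have /allP/(_ B BL)/and3P[B_gt1 v29 vE] : all (fun B => [&& 1 < B,
     (24 * B + 8) %% 29 \notin qvals 29 8 & (8 * B.-1 + 1) %% 29 \notin qvals 29 1])
     [:: 3; 6; 10; 12; 13; 14; 15; 18; 20; 23; 24; 25; 26; 28] by vm_compute.
rewrite (_ : 841 * n + 29 * B = 29 * (29 * n + B)); last by rewrite mulnDr mulnA.
apply: (b232 char2 prim29); [exact: gt1E | by rewrite mod_progression |].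
by rewrite predE ?mod_progression // ltnW.
Qed.
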